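(* Let $b$ be locally integrable on $\mathbb{Q}_p^n$, $0<\alpha<n$, $1<r<n/\alpha$, $0<\lambda<n-\alpha r$. (T.1) If $1/q=1/r-\alpha/(n-\lambda)$, then $b\in\mathrm{BMO}(\mathbb{Q}_p^n)$ if and only if $\mathcal{M}^p_{\alpha,b}$ is bounded from $L^{r,\lambda}(\mathbb{Q}_p^n)$ to $L^{q,\lambda}(\mathbb{Q}_p^n)$. (T.2) If $1/q=1/r-\alpha/n$ and $\lambda/r=\mu/q$, then $b\in\mathrm{BMO}(\mathbb{Q}_p^n)$ if and only if $\mathcal{M}^p_{\alpha,b}$ is bounded from $L^{r,\lambda}(\mathbb{Q}_p^n)$ to $L^{q,\mu}(\mathbb{Q}_p^n)$.
   Context: Fix a prime $p$; $\mathbb{Q}_p^n$ with $|x|_p=\max_j|x_j|_p$; balls $B_\gamma(x)=\{y:|y-x|_p\le p^\gamma\}$; Haar measure with $|B_\gamma(x)|_h=p^{n\gamma}$; $f_B=|B|_h^{-1}\int_Bf$. $\mathcal{M}^p_{\alpha,b}(f)(x)=\sup_{\gamma\in\mathbb{Z}}|B_\gamma(x)|_h^{\alpha/n-1}\int_{B_\gamma(x)}|b(x)-b(y)||f(y)|dy$. $\mathrm{BMO}$: $\sup_{\gamma,x}|B_\gamma(x)|_h^{-1}\int_{B_\gamma(x)}|b-b_{B_\gamma(x)}|<\infty$. Morrey space $L^{q,\lambda}(\mathbb{Q}_p^n)$ ($1\le q<\infty$, $\lambda\ge0$): $f\in L^q_{\mathrm{loc}}$ with $\|f\|_{L^{q,\lambda}}=\sup_{\gamma,x}\big(|B_\gamma(x)|_h^{-\lambda/n}\int_{B_\gamma(x)}|f|^q\big)^{1/q}<\infty$.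 *)

(* Defs.v *)
From HB Require Import structures.
From mathcomp Require Import all_boot all_order all_algebra.
From mathcomp Require Import all_classical all_reals all_analysis.
From mathcomp Require Import measurable_realfun.
Import Order.TTheory GRing.Theory Num.Theory.

Unset Printing Implicit Defensive.

Local Open Scope classical_set_scope.
Local Open Scope ring_scope.

(* The p-adic numbers Q_p, via their (unique) p-adic digit expansion    *)
(*   x = sum_{k >= N} a_k p^k ,  a_k in {0,...,p-1}.                    *)
(* For p prime, 'I_p.-1.+1 is 'I_p (the digits 0..p-1).                 *)
Definition Qp (p : nat) :=
  {a : int -> 'I_p.-1.+1 | exists N : int, forall k : int, k < N -> a k = ord0}.

Definition Qp0 (p : nat) : Qp p :=
  exist _ (fun _ => ord0) (ex_intro _ 0 (fun _ _ => erefl)).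

HB.instance Definition _ p := gen_eqMixin (Qp p).
HB.instance Definition _ p := gen_choiceMixin (Qp p).
HB.instance Definition _ p := isPointed.Build (Qp p) (Qp0 p).

Definition pdigit (p : nat) (x : Qp p) (k : int) : 'I_p.-1.+1 := proj1_sig x k.
Arguments pdigit {p}.

Definition Qpn (p n : nat) := 'I_n -> Qp p.
HB.instance Definition _ p n := gen_eqMixin (Qpn p n).
HB.instance Definition _ p n := gen_choiceMixin (Qpn p n).
HB.instance Definition _ p n := isPointed.Build (Qpn p n) (fun _ => Qp0 p).

(* The closed ball B_gamma(x) = {y : |y - x|_p <= p^gamma}, where
   |z|_p = max_j |z_j|_p.  For y_j, x_j in Q_p one has
   |y_j - x_j|_p <= p^gamma  iff  the digits of y_j and x_j agree at all
   indices k < -gamma (the valuation of y_j - x_j is the first index at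
   which the digits differ). *)
Definition pball (p n : nat) (x : Qpn p n) (gamma : int) : set (Qpn p n) :=
  [set y : Qpn p n | forall (j : 'I_n) (k : int), k < - gamma -> pdigit (y j) k = pdigit (x j) k].

Arguments pball {p n}.

Definition pballs (p n : nat) : set (set (Qpn p n)) :=
  [set B | exists (x : Qpn p n) (gamma : int), B = pball x gamma].

(* Q_p^n with its Borel sigma-algebra (generated by the balls). *)
Definition QpnM (p n : nat) := g_sigma_algebraType (pballs p n).

Definition ballM (p n : nat) (x : QpnM p n) (gamma : int) : set (QpnM p n) :=
  pball x gamma.

Arguments ballM {p n}.
(* Haar measure of a ball of radius p^gamma : p^(n gamma) *)
Definition ballvol (R : realType) (p n : nat) (gamma : int) : R :=
  (p%:R : R) ^ (n%:Z * gamma).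


Section Ops.
Variables (R : realType) (p n : nat).
Variable mu : {measure set (QpnM p n) -> \bar R}.

Local Open Scope ereal_scope.

Definition loc_integrable (b : QpnM p n -> R) : Prop :=
  measurable_fun [set: QpnM p n] b /\
  forall x gamma, mu.-integrable (ballM x gamma) (EFin \o b).

Definition ball_avg (b : QpnM p n -> R) (x : QpnM p n) (gamma : int) : R :=
  ((ballvol R p n gamma)^-1 * fine (\int[mu]_(y in ballM x gamma) (b y)%:E))%R.

Definition isBMO (b : QpnM p n -> R) : Prop :=
  ereal_sup [set z | exists x gamma, z =
      ((ballvol R p n gamma)^-1)%:E *
      \int[mu]_(y in ballM x gamma) (`| b y - ball_avg b x gamma |)%:E]
   < +oo.

Definition frac_max_comm (alpha : R) (b f : QpnM p n -> R) (x : QpnM p n)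
  : \bar R :=
  ereal_sup [set z | exists gamma : int, z =
      ((ballvol R p n gamma) `^ (alpha / n%:R - 1))%:E *
      \int[mu]_(y in ballM x gamma) (`| b x - b y | * `| f y |)%:E].

Definition morrey_norm (q lambda : R) (F : QpnM p n -> \bar R) : \bar R :=
  ereal_sup [set z | exists x gamma, z =
      (((ballvol R p n gamma) `^ (- lambda / n%:R))%:E *
        \int[mu]_(y in ballM x gamma) (`| F y | `^ q)) `^ (q^-1)].

Definition in_morrey (q lambda : R) (f : QpnM p n -> R) : Prop :=
  measurable_fun [set: QpnM p n] f /\ morrey_norm q lambda (EFin \o f) < +oo.

Definition frac_max_comm_bounded (alpha : R) (b : QpnM p n -> R)
  (r lambda q mu' : R) : Prop :=
  exists C : R, (0 < C)%R /\ forall f : QpnM p n -> R, in_morrey r lambda f ->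
    measurable_fun [set: QpnM p n] (frac_max_comm alpha b f) /\
    morrey_norm q mu' (frac_max_comm alpha b f) <= C%:E * morrey_norm r lambda (EFin \o f).

End Ops.

Arguments loc_integrable {R p n}.
Arguments ball_avg {R p n}.
Arguments isBMO {R p n}.
Arguments frac_max_comm {R p n}.
Arguments morrey_norm {R p n}.
Arguments in_morrey {R p n}.
Arguments frac_max_comm_bounded {R p n}.

(* Main.v *)
Require Import Defs.
From HB Require Import structures.
From mathcomp Require Import all_boot all_order all_algebra.
From mathcomp Require Import all_classical all_reals all_analysis.
From mathcomp Require Import measurable_realfun.
From mathcomp Require Import ring lra zify.
Import Order.TTheory GRing.Theory Num.Theory.
Local Open Scope classical_set_scope.
Local Open Scope ring_scope.

(* In the ultrametric space Q_p^n the averages over the balls of radius p^(g0-j)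
   contained in a fixed ball form a martingale in j, and every estimate below is
   a summation by parts along it: if S_j increases in j and is constant on the
   balls of level j, an increment w(S_(j+1)) - w(S_j) can be integrated against a
   function or against its averages alike.  With S_j a running maximum of averages this
   gives Doob's L^P inequality and a substitute for the weak type (1,1)
   inequality; with S_j a running maximum of |b_j - b_0|^(1/2) it gives
   Garsia's form of the John-Nirenberg inequality.

   For f in the Morrey space and 1 < s < r, Hoelder's inequality bounds the
   average defining the operator by V^(alpha/n) H G, where G^s is the average of
   |f|^s over the ball B, V is the volume of B and H = 2(|b(x) - b_B| + const).
   With A the Morrey norm of f and k = (n - lambda)/(n r), the bound G <= 2 A V^(-k) gives
   (V^(alpha/n) G)^q <= const A^(q-r) G^r, so on balls inside a given ball B0 one has to
   integrate sup G^r H^q.  Replacing G^r by its running maximum, writing it as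
   the sum of its increments, and using the John-Nirenberg inequality on the
   ball where each increment lives, leaves Doob's inequality for |f|^s.  Balls
   larger than B0 contribute a convergent power of their volume.  The second part
   follows from the first by inclusion of Morrey spaces, and the converses by testing on
   indicator functions of balls. *)

Set Implicit Arguments.
Unset Strict Implicit.
Unset Printing Implicit Defensive.

(** * Ultrametric geometry of balls and countable partitions into balls of one radius *)

Section Balls.
Context {p n : nat}.
Implicit Types (x y z : QpnM p n) (g h : int).

Lemma ballM_refl x g : ballM x g x.
Proof. by []. Qed.

Lemma ballM_eq x y g : ballM x g y -> ballM y g = ballM x g.
Proof.
move=> xy; apply/seteqP; split=> z zb j k kg; first by rewrite zb// xy.
by rewrite zb// xy.
Qed.

Lemma ballM_sym x y g : ballM x g y -> ballM y g x.
Proof. by move/ballM_eq ->. Qed.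

Lemma subset_ballM x g h : g <= h -> ballM x g `<=` ballM x h.
Proof. by move=> gh y yb j k kh; apply: yb; apply: lt_le_trans kh _; rewrite lerN2. Qed.

Lemma ballM_eqW x y g h : g <= h -> ballM x g y -> ballM y h = ballM x h.
Proof. by move=> gh /(subset_ballM gh)/ballM_eq. Qed.

Lemma measurable_ballM x g : measurable (ballM x g).
Proof. by apply: sub_sigma_algebra; exists x, g. Qed.

(** [s.1] is the index of the first digit and [s.2] the finite list of digits from there on; past
    its end [nth] returns the digit 0. These codes form a countable type, and the points they
    describe are dense. *)
Definition Qp_of_digits (s : int * seq 'I_p.-1.+1) : Qp p.
Proof.
exists (fun k => if k < s.1 then ord0 else nth ord0 s.2 `|k - s.1|%N).
by exists s.1 => k ->.
Defined.

Lemma Qp_approx (a : Qp p) g : exists s : int * seq 'I_p.-1.+1,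
  forall k, k < g -> pdigit (Qp_of_digits s) k = pdigit a k.
Proof.
case: (proj2_sig a) => N aN.
exists (N, mkseq (fun i => pdigit a (N + i%:Z)) `|g - N|%N) => k kg.
rewrite /pdigit/=; case: ltP => [/aN ->//|Nk].
rewrite nth_mkseq; last by lia.
by congr (proj1_sig a _); lia.
Qed.

Definition Qpn_of_nat (i : nat) : QpnM p n :=
  if unpickle i is Some s then
    fun j => Qp_of_digits ((s : {ffun 'I_n -> int * seq 'I_p.-1.+1}) j)
  else fun=> Qp0 p.

Lemma Qpn_of_nat_dense x g : exists i, ballM x g (Qpn_of_nat i).
Proof.
have /choice[s sP] := fun j => Qp_approx (x j) (- g).
exists (pickle [ffun j => s j]); rewrite /Qpn_of_nat pickleK => j k kg.
by rewrite ffunE sP.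
Qed.

(* The [g]-balls, enumerated without repetition: [partM g i] is empty if the
   [i]-th centre lies in an earlier ball. *)
Definition partM g (i : nat) : set (QpnM p n) :=
  if `[< exists2 j, (j < i)%N & ballM (Qpn_of_nat j) g (Qpn_of_nat i) >]
  then set0 else ballM (Qpn_of_nat i) g.

Lemma partM_set0_or_ball g i : partM g i = set0 \/ partM g i = ballM (Qpn_of_nat i) g.
Proof. by rewrite /partM; case: ifP; [left|right]. Qed.

Lemma measurable_partM g i : measurable (partM g i).
Proof. by case: (partM_set0_or_ball g i) => ->//; exact: measurable_ballM. Qed.

Lemma bigcup_partM g : \bigcup_i partM g i = setT.
Proof.
apply/seteqP; split=> // x _.
have ex : exists i, `[< ballM x g (Qpn_of_nat i) >].
  by have [i xi] := Qpn_of_nat_dense x g; exists i; exact/asboolP.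
case: (ex_minnP ex) => i /asboolP xi imin; exists i => //.
rewrite /partM; case: ifPn => [/asboolP[j ji jb]|_]; last exact: ballM_sym.
suff : (i <= j)%N by rewrite leqNgt ji.
by apply: imin; apply/asboolP; rewrite -(ballM_eq xi); exact: ballM_sym.
Qed.

Lemma trivIset_partM g : trivIset setT (partM g).
Proof.
apply/trivIsetP => i j _ _.
wlog ij : i j / (i < j)%N => [H|_].
  rewrite neq_lt => /orP[ij|ij]; first by rewrite H// ?neq_lt ?ij.
  by rewrite setIC H// ?neq_lt ?ij.
rewrite /partM; case: ifPn => _; first by rewrite set0I.
case: asboolP => [_|nij]; first by rewrite setI0.
apply/seteqP; split=> // x [xi xj]; apply: nij; exists i => //.
by rewrite -(ballM_eq xi); exact: ballM_sym.
Qed.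

(** In martingale terms: measurability with respect to the partition into balls of level [g]. *)
Definition lconst T g (u : QpnM p n -> T) := forall x y, ballM x g y -> u y = u x.

Lemma lconst_le T g h (u : QpnM p n -> T) : h <= g -> lconst g u -> lconst h u.
Proof. by move=> hg uc x y /(subset_ballM hg)/uc. Qed.

(** A preimage is the union of the countably many pieces of [partM g] whose centre it contains. *)
Lemma measurable_lconst d (T : measurableType d) g (u : QpnM p n -> T) :
  lconst g u -> measurable_fun setT u.
Proof.
move=> uc _ Y mY; rewrite setTI.
have -> : u @^-1` Y = \bigcup_i (if `[< Y (u (Qpn_of_nat i)) >] then partM g i else set0).
  rewrite -[LHS]setTI -(bigcup_partM g) setI_bigcupl; apply: eq_bigcupr => i _.
  case: (partM_set0_or_ball g i) => ->; first by rewrite set0I; case: ifP.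
  apply/seteqP; split=> [x [xi /=]|x]; first by rewrite (uc _ _ xi) => ?; rewrite asboolT.
  by case: asboolP => // Yi xi; split => //=; rewrite (uc _ _ xi).
by apply: bigcup_measurable => i _; case: ifP => // _; exact: measurable_partM.
Qed.

End Balls.

(** * Volumes of balls and comparison of integrals level by level *)

Section Haar.
Context {R : realType} {p n : nat}.
Hypothesis p_pr : prime p.
Variable mu : {measure set (QpnM p n) -> \bar R}.
Hypothesis muB : forall (x : QpnM p n) g, mu (ballM x g) = (ballvol R p n g)%:E.
Implicit Types (x y z : QpnM p n) (g h : int).
Local Notation V := (ballvol R p n).
Local Notation mball := (measurable_ballM _ _).

Lemma ballvol_gt0 g : 0 < V g.
Proof. by rewrite /ballvol exprz_gt0// ltr0n prime_gt0. Qed.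

Lemma ballvolD g (k : nat) : V (g + k%:Z) = V g * (p%:R ^+ n) ^+ k.
Proof.
rewrite /ballvol mulrDr expfzDr ?pnatr_eq0 -?lt0n ?prime_gt0//.
by rewrite -exprM -PoszM.
Qed.

(** The substitute for conditional expectation: on each piece of the partition into [g]-balls the
    weight [c] is a constant and leaves the integral, so a comparison of unweighted integrals over
    every [g]-ball survives the weight. *)
Lemma integral_lconst_le x0 g0 g (c : QpnM p n -> R) (u v : QpnM p n -> \bar R) :
  g <= g0 -> lconst g c -> (forall x, 0 <= c x) ->
  measurable_fun setT u -> measurable_fun setT v ->
  (forall x, 0 <= u x)%E -> (forall x, 0 <= v x)%E ->
  (forall x, ballM x0 g0 x ->
    \int[mu]_(y in ballM x g) u y <= \int[mu]_(y in ballM x g) v y)%E ->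
  (\int[mu]_(y in ballM x0 g0) ((c y)%:E * u y) <=
   \int[mu]_(y in ballM x0 g0) ((c y)%:E * v y))%E.
Proof.
move=> gg0 cc c0 mu_ mv u0 v0 uv.
have mc : measurable_fun setT (EFin \o c).
  by apply/measurable_EFinP; exact: measurable_lconst cc.
have cE w : measurable_fun setT w -> (forall x, 0 <= w x)%E ->
    (\int[mu]_(y in ballM x0 g0) ((c y)%:E * w y) =
    \sum_(i <oo) \int[mu]_(y in ballM x0 g0 `&` partM g i) ((c y)%:E * w y))%E.
  move=> mw w0.
  rewrite -{1}(setIT (ballM x0 g0)) -(bigcup_partM g) setI_bigcupr.
  apply: ge0_integral_bigcup => [i||y _|].
  - by apply: measurableI; [exact: mball|exact: measurable_partM].
  - apply/(@measurable_funS _ _ _ _ setT) => //.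
    exact: emeasurable_funM.
  - by rewrite mule_ge0 ?lee_fin.
  - by apply: trivIset_setIl; exact: trivIset_partM.
rewrite !cE//; apply: lee_nneseries => [i _ _|i _].
  by apply: integral_ge0 => y _; rewrite mule_ge0 ?lee_fin.
case: (@partM_set0_or_ball p n g i) => ->; first by rewrite setI0 !integral_set0.
set z := Qpn_of_nat i.
(* Since [g <= g0], a [g]-ball that meets the large ball lies inside it; otherwise the piece
   contributes nothing. *)
have [[y [y0 yz]]|/set0P/negP/negPn/eqP->] := pselect (ballM x0 g0 `&` ballM z g !=set0); last first.
  by rewrite !integral_set0.
have zg : ballM x0 g0 z.
  by rewrite -(ballM_eq y0); apply: ballM_sym; exact: subset_ballM yz.
have -> : ballM x0 g0 `&` ballM z g = ballM z g.
  by apply: setIidr; rewrite -(ballM_eq zg); exact: subset_ballM.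
have cint w : measurable_fun setT w -> (forall x, 0 <= w x)%E ->
    (\int[mu]_(y in ballM z g) ((c y)%:E * w y) =
     (c z)%:E * \int[mu]_(y in ballM z g) w y)%E.
  move=> mw w0; rewrite -ge0_integralZl//; first last.
  - by rewrite lee_fin.
  - exact: measurable_funTS.
  - exact: mball.
  by apply: eq_integral => t; rewrite inE => /cc ->.
by rewrite !cint// lee_wpmul2l ?lee_fin ?uv.
Qed.

End Haar.

Lemma measurable_fun_powR d (T : measurableType d) (R : realType) (u : T -> R) (r : R) :
  measurable_fun setT u -> measurable_fun setT (fun x => u x `^ r).
Proof. exact: (measurableT_comp (measurable_powR r)). Qed.

(** * Averages over balls and summation by parts *)

Section Averages.
Context {R : realType} {p n : nat}.
Hypothesis p_pr : prime p.
Variable mu : {measure set (QpnM p n) -> \bar R}.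
Hypothesis muB : forall (x : QpnM p n) g, mu (ballM x g) = (ballvol R p n g)%:E.
Implicit Types (x y z : QpnM p n) (g h : int) (u v : QpnM p n -> R).
Local Notation V := (ballvol R p n).
Local Notation mball := (measurable_ballM _ _).
Local Notation avg := (ball_avg mu).
Local Notation V_gt0 g := (@ballvol_gt0 R p n p_pr g).

Lemma lconst_ball_avg u g : lconst g (fun x => avg u x g).
Proof. by move=> x y xy; rewrite /ball_avg (ballM_eq xy). Qed.

Lemma ball_int_cst x g (c : R) : (\int[mu]_(y in ballM x g) c%:E = (c * V g)%:E)%E.
Proof. by rewrite integral_cst ?muB//; exact: mball. Qed.

Lemma ball_int_le x g u v : measurable_fun setT u -> measurable_fun setT v ->
  (forall y, ballM x g y -> 0 <= u y) -> (forall y, ballM x g y -> u y <= v y) ->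
  (\int[mu]_(y in ballM x g) (u y)%:E <= \int[mu]_(y in ballM x g) (v y)%:E)%E.
Proof.
move=> mu_ mv u0 uv; apply: ge0_le_integral => //=.
- exact: mball.
- by apply/measurable_EFinP; exact: measurable_funTS.
- by apply/measurable_EFinP; exact: measurable_funTS.
Qed.

Lemma ball_int_ge0 x g u : (forall y, ballM x g y -> 0 <= u y) ->
  (0 <= \int[mu]_(y in ballM x g) (u y)%:E)%E.
Proof. by move=> u0; apply: integral_ge0 => y /u0; rewrite lee_fin. Qed.

Lemma ball_intD x g u v : measurable_fun setT u -> measurable_fun setT v ->
  (forall y, ballM x g y -> 0 <= u y) -> (forall y, ballM x g y -> 0 <= v y) ->
  (\int[mu]_(y in ballM x g) (u y + v y)%:E =
   \int[mu]_(y in ballM x g) (u y)%:E + \int[mu]_(y in ballM x g) (v y)%:E)%E.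
Proof.
move=> mu_ mv u0 v0; rewrite -ge0_integralD//=.
- exact: mball.
- by apply/measurable_EFinP; exact: measurable_funTS.
- by apply/measurable_EFinP; exact: measurable_funTS.
Qed.

Lemma ball_intZ x g (c : R) u : measurable_fun setT u -> 0 <= c ->
  (forall y, ballM x g y -> 0 <= u y) ->
  (\int[mu]_(y in ballM x g) (c * u y)%:E =
   c%:E * \int[mu]_(y in ballM x g) (u y)%:E)%E.
Proof.
move=> mu_ c0 u0; rewrite -ge0_integralZl//=.
- exact: mball.
- by apply/measurable_EFinP; exact: measurable_funTS.
Qed.

Lemma ball_int_sum x g (N : nat) (f : nat -> QpnM p n -> R) :
  (forall i, measurable_fun setT (f i)) -> (forall i y, 0 <= f i y) ->
  (\int[mu]_(y in ballM x g) (\sum_(i < N) f i y)%:E =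
   \sum_(i < N) \int[mu]_(y in ballM x g) (f i y)%:E)%E.
Proof.
move=> mf f0; rewrite -ge0_integral_sum//=.
- by apply: eq_integral => y _; rewrite sumEFin.
- exact: mball.
- by move=> i; apply/measurable_EFinP; exact: measurable_funTS.
- by move=> i y _; rewrite lee_fin.
Qed.

Section Avg.
Variable u : QpnM p n -> R.
Hypothesis lu : loc_integrable mu u.

Let mu_ : measurable_fun setT u. Proof. by case: lu. Qed.

Lemma ball_avgE x g : (\int[mu]_(y in ballM x g) (u y)%:E = (avg u x g * V g)%:E)%E.
Proof.
rewrite /ball_avg mulrC mulrA divff ?mul1r ?gt_eqF ?(V_gt0 _)// fineK//.
by apply: integrable_fin_num; [exact: mball|exact: lu.2].
Qed.

Lemma ball_avg_ge0 x g : (forall y, 0 <= u y) -> 0 <= avg u x g.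
Proof.
move=> u0; rewrite /ball_avg mulr_ge0 ?invr_ge0 ?(ltW (V_gt0 _))// fine_ge0//.
by apply: integral_ge0 => y _; rewrite lee_fin.
Qed.

End Avg.

(** Index [N] has seen the seed [m0] and the entries [e 0] to [e (N-1)]; the entry [e j] enters at
    index [j.+1]. *)
Fixpoint runmax (m0 : R) (e : nat -> R) (N : nat) : R :=
  if N is k.+1 then Num.max (runmax m0 e k) (e k) else m0.

Lemma runmax_le m0 e : {homo runmax m0 e : i j / (i <= j)%N >-> i <= j}.
Proof.
by apply: homo_leq => // [y x z|i]; [exact: le_trans|rewrite /= le_max lexx].
Qed.

Lemma runmax_ge m0 e i N : (i < N)%N -> e i <= runmax m0 e N.
Proof. by move=> iN; rewrite (le_trans _ (runmax_le _ _ iN))//= le_max lexx orbT. Qed.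

Lemma runmax_ub m0 e N c : m0 <= c -> (forall i, (i < N)%N -> e i <= c) -> runmax m0 e N <= c.
Proof.
move=> m0c; elim: N => //= N IH ec; rewrite ge_max ec// IH// => i iN.
by rewrite ec// ltnS ltnW.
Qed.

Lemma eq_runmax m0 e f N : (forall i, (i < N)%N -> e i = f i) -> runmax m0 e N = runmax m0 f N.
Proof.
elim: N => //= N IH ef; rewrite ef// IH// => i iN; by rewrite ef// ltnS ltnW.
Qed.

Lemma lconst_runmax m0 (e : nat -> QpnM p n -> R) N h :
  (forall i, (i < N)%N -> lconst h (e i)) -> lconst h (fun x => runmax m0 (e ^~ x) N).
Proof. by move=> eh x y xy; apply: eq_runmax => i iN; rewrite (eh i iN x y xy). Qed.

(** The martingale maximal function of [u] seeded with [m0], looking at [N] levels downward from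
    [g0]. *)
Definition avgmax (m0 : R) u g0 (N : nat) x := runmax m0 (fun j => avg u x (g0 - j%:Z)) N.

Lemma lconst_avgmax m0 u g0 N h : (forall i, (i < N)%N -> h <= g0 - i%:Z) ->
  lconst h (avgmax m0 u g0 N).
Proof.
move=> hi; apply: (@lconst_runmax m0 (fun j x => avg u x (g0 - j%:Z))) => i iN.
exact: lconst_le (hi i iN) (@lconst_ball_avg u _).
Qed.

Lemma measurable_avgmax m0 u g0 N : measurable_fun setT (avgmax m0 u g0 N).
Proof.
apply: (@measurable_lconst _ _ _ _ (g0 - N%:Z)); apply: lconst_avgmax => i iN.
by rewrite lerD2l lerN2 lez_nat ltnW.
Qed.

(* Summation by parts: [S = avgmax] only increases at steps where it equals the
   current average, and averaging can be moved off [u] against increments that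
   are already constant on the balls of that step. *)
Lemma avgmax_abel m0 (w : R -> R) u x0 g0 N : loc_integrable mu u -> (forall x, 0 <= u x) ->
  0 <= m0 -> (forall a b, m0 <= a -> a <= b -> w a <= w b) ->
  (\int[mu]_(x in ballM x0 g0) (\sum_(j < N)
      (w (avgmax m0 u g0 j.+1 x) - w (avgmax m0 u g0 j x)) * avgmax m0 u g0 j.+1 x)%:E <=
   \int[mu]_(x in ballM x0 g0) ((w (avgmax m0 u g0 N x) - w m0) * u x)%:E)%E.
Proof.
move=> lu u0 m00 wh; set S := avgmax m0 u g0.
have mu_ : measurable_fun setT u by case: lu.
have Sm0 j x : m0 <= S j x by exact: (@runmax_le m0 _ 0 j).
have SS j x : S j x <= S j.+1 x by exact: runmax_le.
(* Index [j.+1] only involves averages of level [g0 - j] and above, so the increment is constant on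
   the balls of level [g0 - j], where [integral_lconst_le] will exchange the average for [u]. *)
have wc j : lconst (g0 - j%:Z) (fun x => w (S j.+1 x) - w (S j x)).
  have H k : (k <= j.+1)%N -> lconst (g0 - j%:Z) (S k).
    by move=> kj; apply: lconst_avgmax => i ik; rewrite lerD2l lerN2 lez_nat; lia.
  by move=> x y xy; rewrite (H j.+1 _ x y)// (H j _ x y).
have mw j : measurable_fun setT (fun x => w (S j.+1 x) - w (S j x)).
  exact: measurable_lconst (wc j).
have w0 j x : 0 <= w (S j.+1 x) - w (S j x) by rewrite subr_ge0 wh.
have mavg h : measurable_fun setT (fun x => avg u x h).
  exact: measurable_lconst (@lconst_ball_avg u h).
rewrite (eq_integral (fun x => (\sum_(j < N) (w (S j.+1 x) - w (S j x)) * avg u x (g0 - j%:Z))%:E));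
  last first.
  move=> x _; congr EFin; apply: eq_bigr => j _.
  rewrite /S /avgmax /=; case: (leP (avg u x (g0 - j%:Z)) (runmax m0 (fun j => avg u x (g0 - j%:Z)) j)) => // h.
  by rewrite subrr !mul0r.
rewrite (@ball_int_sum _ _ N (fun j x => (w (S j.+1 x) - w (S j x)) * avg u x (g0 - j%:Z))); last 2 first.
- by move=> j; exact: measurable_funM.
- by move=> j x; rewrite mulr_ge0// ball_avg_ge0.
rewrite [leRHS](eq_integral (fun x => (\sum_(j < N) (w (S j.+1 x) - w (S j x)) * u x)%:E));
  last first.
  by move=> x _; rewrite -mulr_suml -(big_mkord xpredT (fun j => w (S j.+1 x) - w (S j x))) telescope_sumr.
rewrite (@ball_int_sum _ _ N (fun j x => (w (S j.+1 x) - w (S j x)) * u x)); last 2 first.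
- by move=> j; exact: measurable_funM.
- by move=> j x; rewrite mulr_ge0.
apply: lee_sum => j _.
under eq_integral do rewrite EFinM; under [leRHS]eq_integral do rewrite EFinM.
apply: (@integral_lconst_le R p n mu x0 g0 (g0 - j%:Z) _ (EFin \o avg u ^~ (g0 - j%:Z)) (EFin \o u)) => //.
- by rewrite gerBl.
- exact/measurable_EFinP.
- exact/measurable_EFinP.
- by move=> x; rewrite /= lee_fin ball_avg_ge0.
- move=> x _; rewrite (eq_integral (cst (avg u x (g0 - j%:Z))%:E)).
    by rewrite ball_int_cst// -ball_avgE.
  by move=> y; rewrite inE => /ballM_eq xy /=; rewrite /ball_avg xy.
Qed.

End Averages.

(** * Maximal inequalities *)

Section Maximal.
Context {R : realType} {p n : nat}.
Hypothesis p_pr : prime p.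
Variable mu : {measure set (QpnM p n) -> \bar R}.
Hypothesis muB : forall (x : QpnM p n) g, mu (ballM x g) = (ballvol R p n g)%:E.
Implicit Types (x y z : QpnM p n) (g h : int) (u v : QpnM p n -> R).
Local Notation V := (ballvol R p n).
Local Notation mball := (measurable_ballM _ _).
Local Notation avg := (ball_avg mu).
Local Notation V_gt0 g := (@ballvol_gt0 R p n p_pr g).

Lemma measurable_avgmax_comp (f : R -> R) m0 u g0 N :
  measurable_fun setT (fun x => f (avgmax mu m0 u g0 N x)).
Proof.
apply: (@measurable_lconst _ _ _ _ (g0 - N%:Z)) => x y xy; congr f; move: x y xy.
by apply: lconst_avgmax => i iN; rewrite lerD2l lerN2 lez_nat ltnW.
Qed.

(** Puts the growth of a square root into the form of an increment of the weight [-1/sqrt] times the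
    new value, which is the form summed in [avgmax_abel]. *)
Lemma sqrtr_increment (s t : R) : 1 <= s -> s <= t ->
  Num.sqrt t - Num.sqrt s <= ((Num.sqrt s)^-1 - (Num.sqrt t)^-1) * t.
Proof.
move=> s1 st; have s0 : 0 < s by lra.
have t0 : 0 < t by lra.
have a0 : 0 < Num.sqrt s by rewrite sqrtr_gt0.
have ab : Num.sqrt s <= Num.sqrt t by exact: ler_wsqrtr.
rewrite -[X in _ * X](sqr_sqrtr (ltW t0)).
set a := Num.sqrt s in a0 ab *; set b := Num.sqrt t in ab *.
have -> : (a^-1 - b^-1) * b ^+ 2 = (b - a) * (b / a) by field; lra.
by rewrite ler_peMr ?subr_ge0// ler_pdivlMr ?mul1r.
Qed.

(* The substitute for the weak type (1,1) inequality. *)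
Lemma sqrt_avgmax_int u x0 g0 N D : loc_integrable mu u -> (forall x, 0 <= u x) ->
  (\int[mu]_(x in ballM x0 g0) (u x)%:E <= (D * V g0)%:E)%E ->
  (\int[mu]_(x in ballM x0 g0) (Num.sqrt (avgmax mu 1 u g0 N x))%:E <= ((1 + D) * V g0)%:E)%E.
Proof.
move=> lu u0 uD; have mu_ : measurable_fun setT u by case: lu.
set S := avgmax mu 1 u g0.
have S1 j x : 1 <= S j x by exact: (@runmax_le _ 1 _ 0 j).
have SS j x : S j x <= S j.+1 x by exact: runmax_le.
(* Started from the seed 1, this increasing weight grows by at most 1 in all, so the right side of
   [avgmax_abel] is at most the integral of [u]. *)
pose w (x : R) := - (Num.sqrt x)^-1.
have wh a b : 1 <= a -> a <= b -> w a <= w b.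
  move=> a1 ab; rewrite lerN2 lef_pV2 ?posrE ?sqrtr_gt0; [|lra..].
  exact: ler_wsqrtr.
pose sg x := \sum_(j < N) (w (S j.+1 x) - w (S j x)) * S j.+1 x.
have sg0 x : 0 <= sg x.
  by apply: sumr_ge0 => j _; rewrite mulr_ge0 ?subr_ge0 ?wh// (le_trans _ (S1 _ _)).
have mw j : measurable_fun setT (fun x => w (S j x)).
  exact: measurable_avgmax_comp.
have msg : measurable_fun setT sg.
  apply: measurable_sum => j; apply: measurable_funM; last exact: measurable_avgmax.
  exact: measurable_funB.
apply: (@le_trans _ _ (\int[mu]_(x in ballM x0 g0) (1 + sg x)%:E)%E).
  apply: ball_int_le => [|||x _].
  - exact: measurable_avgmax_comp.
  - exact: measurable_funD.
  - by move=> x _; exact: sqrtr_ge0.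
  - rewrite addrC -lerBlDr /sg -[X in _ - X]sqrtr1.
    have -> : Num.sqrt (S N x) - Num.sqrt 1 = \sum_(j < N) (Num.sqrt (S j.+1 x) - Num.sqrt (S j x)).
      by rewrite -(big_mkord xpredT (fun j => Num.sqrt (S j.+1 x) - Num.sqrt (S j x))) telescope_sumr.
    apply: ler_sum => j _; apply: le_trans (sqrtr_increment (S1 j x) (SS j x)) _.
    by rewrite /w opprK addrC.
rewrite ball_intD//.
rewrite (ball_int_cst muB) mulrDl EFinD leeD2l//.
apply: le_trans uD; apply: le_trans (avgmax_abel p_pr muB x0 g0 N lu u0 ler01 wh) _.
apply: ball_int_le => [|||x _].
- by apply: measurable_funM => //; exact: measurable_funB.
- by [].
- by move=> x _; rewrite mulr_ge0 ?subr_ge0// wh// S1.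
- rewrite ler_piMl// /w sqrtr1 invr1 opprK addrC lerBlDr lerDl invr_ge0.
  exact: sqrtr_ge0.
Qed.

(** The counterpart of [sqrtr_increment] for the weight x^(P-1). The left side is (t^(P-1) -
    s^(P-1)) t + s^(P-1) (t - s), and the last term is at most 1/(P-1) times the first. *)
Lemma powR_increment (P s t : R) : 1 < P -> 0 <= s -> s <= t ->
  t `^ P - s `^ P <= (1 + (P - 1)^-1) * ((t `^ (P - 1) - s `^ (P - 1)) * t).
Proof.
move=> P1 s0 st; have P0 : 0 < P by lra.
have e0 : 0 < P - 1 by lra.
have t0 : 0 <= t by lra.
have H (a : R) : 0 <= a -> a `^ P = a * a `^ (P - 1) by move=> a0; rewrite mulr_powRB1.
have mono : s `^ (P - 1) <= t `^ (P - 1) by rewrite ge0_ler_powR ?nnegrE ?(ltW e0).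
move: s0; rewrite le_eqVlt => /predU1P[<-|s0].
  rewrite !powR0 ?(gt_eqF e0) ?(gt_eqF P0)// !subr0 H// mulrC ler_peMl ?mulr_ge0 ?powR_ge0//.
  by rewrite lerDl invr_ge0 ltW.
have t0' : 0 < t by lra.
rewrite !H ?(ltW s0)//.
(* After clearing factors this is (t/s)^(P-1) >= 1 + (P-1) (1 - s/t), which follows from exp y >= 1
   + y and ln y <= y - 1. *)
suff K : s `^ (P - 1) * (t - s) <= (P - 1)^-1 * ((t `^ (P - 1) - s `^ (P - 1)) * t).
  set A := t `^ _ in K *; set B := s `^ _ in K *.
  rewrite mulrDl mul1r (_ : t * A - s * B = (A - B) * t + B * (t - s)); last by ring.
  by rewrite lerD2l.
rewrite -ler_pdivrMl ?invr_gt0// invrK.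
have -> : t `^ (P - 1) = s `^ (P - 1) * (t / s) `^ (P - 1).
  by rewrite -powRM ?divr_ge0 ?(ltW s0)// mulrC divfK ?gt_eqF.
have : 1 + (P - 1) * (1 - s / t) <= (t / s) `^ (P - 1).
  rewrite /powR ifF; last by rewrite gt_eqF ?divr_gt0.
  apply: le_trans (expR_ge1Dx _); rewrite lerD2l ler_wpM2l ?(ltW e0)//.
  rewrite -[t / s]invrK lnV ?posrE ?invr_gt0 ?divr_gt0// invf_div.
  have st0 := divr_gt0 s0 t0'.
  have := @le_ln1Dx R (s / t - 1).
  by rewrite [1 + _]addrC subrK => H1; have := H1 ltac:(lra); lra.
set A := powR _ _; set B := powR s _ => AB.
have B0 : 0 <= B by exact: powR_ge0.
have -> : (P - 1) * (B * (t - s)) = B * ((P - 1) * (1 - s / t) * t).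
  by field; lra.
have -> : (B * A - B) * t = B * ((A - 1) * t) by ring.
by rewrite ler_wpM2l// ler_wpM2r//; lra.
Qed.

(** Young's inequality with a crude constant: either [2 c u <= s] and the first term suffices, or
    [s] is replaced by [2 c u]. The factor 1/2 is chosen for the absorption in [doob]. *)
Lemma powR_young (P c s u : R) : 1 < P -> 1 <= c -> 0 <= s -> 0 <= u ->
  c * (s `^ (P - 1) * u) <= 2^-1 * s `^ P + c * (2 * c) `^ (P - 1) * u `^ P.
Proof.
move=> P1 c1 s0 u0; have e0 : 0 <= P - 1 by lra.
have c0 : 0 <= c by lra.
have P0 : 0 < P by lra.
have [us|us] := leP (2 * c * u) s.
  apply: (@le_trans _ _ (2^-1 * s `^ P)); last first.
    by rewrite lerDl !mulr_ge0 ?powR_ge0.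
  rewrite -(@mulr_powRB1 _ s P)//.
  have := ler_wpM2l (powR_ge0 s (P - 1)) us; lra.
apply: (@le_trans _ _ (c * (2 * c) `^ (P - 1) * u `^ P)); last first.
  by rewrite lerDr mulr_ge0 ?powR_ge0.
rewrite -mulrA ler_wpM2l// -(@mulr_powRB1 _ u P)// mulrCA mulrC ler_wpM2l//.
rewrite -powRM//; last by lra.
by rewrite ge0_ler_powR ?nnegrE ?mulr_ge0//; lra.
Qed.

(** Summation by parts with the weight x^(P-1) bounds the integral of S^P by that of c S^(P-1) u;
    [powR_young] turns part of this into half the integral of S^P, and that half is moved to the
    left. [C] depends on [P] alone. *)
Lemma doob (P : R) : 1 < P -> exists2 C : R, 0 < C &
  forall u x0 g0 N, loc_integrable mu u -> (forall x, 0 <= u x) ->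
  (\int[mu]_(x in ballM x0 g0) (avgmax mu 0 u g0 N x `^ P)%:E <=
   C%:E * \int[mu]_(x in ballM x0 g0) (u x `^ P)%:E)%E.
Proof.
move=> P1; set c := 1 + (P - 1)^-1.
have P0 : 0 < P by lra.
have c1 : 1 <= c by rewrite lerDl invr_ge0; lra.
pose C := 2 * (c * (2 * c) `^ (P - 1)).
have C0 : 0 < C by rewrite /C !mulr_gt0 ?powR_gt0 ?mulr_gt0//; lra.
exists C => // u x0 g0 N lu u0.
have mu_ : measurable_fun setT u by case: lu.
set S := avgmax mu 0 u g0.
have S0 j x : 0 <= S j x by exact: (@runmax_le _ 0 _ 0 j).
have SS j x : S j x <= S j.+1 x by exact: runmax_le.
have mS j : measurable_fun setT (S j) by exact: measurable_avgmax.
have mSp j (r : R) : measurable_fun setT (fun x => S j x `^ r).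
  exact: (@measurable_avgmax_comp (fun a => a `^ r)).
pose w (x : R) := x `^ (P - 1).
have wh a b : 0 <= a -> a <= b -> w a <= w b.
  by move=> a0 ab; rewrite /w ge0_ler_powR ?nnegrE//; lra.
pose sg x := \sum_(j < N) (w (S j.+1 x) - w (S j x)) * S j.+1 x.
have sg0 x : 0 <= sg x.
  by apply: sumr_ge0 => j _; rewrite mulr_ge0 ?subr_ge0 ?wh.
have msg : measurable_fun setT sg.
  apply: measurable_sum => j; apply: measurable_funM => //.
  by apply: measurable_funB; exact: mSp.
have H1 : (\int[mu]_(x in ballM x0 g0) (S N x `^ P)%:E <=
    \int[mu]_(x in ballM x0 g0) (2^-1 * S N x `^ P + C / 2 * u x `^ P)%:E)%E.
  apply: (@le_trans _ _ (\int[mu]_(x in ballM x0 g0) (c * sg x)%:E)%E).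
    apply: ball_int_le => //.
    - exact: measurable_funM.
    - by move=> x _; exact: powR_ge0.
    - move=> x _; have -> : S N x `^ P = \sum_(j < N) (S j.+1 x `^ P - S j x `^ P).
        rewrite -(big_mkord xpredT (fun j => S j.+1 x `^ P - S j x `^ P)) telescope_sumr//.
        by rewrite {3}/S /avgmax/= powR0 ?subr0// gt_eqF.
      rewrite /sg mulr_sumr; apply: ler_sum => j _.
      exact: powR_increment.
  rewrite ball_intZ//; last by lra.
  apply: (@le_trans _ _ (c%:E * \int[mu]_(x in ballM x0 g0) ((w (S N x) - w 0) * u x)%:E)%E).
    rewrite lee_wpmul2l ?lee_fin//; first by lra.
    exact: (avgmax_abel p_pr muB x0 g0 N lu u0 (lexx 0) wh).
  have w0 : w 0 = 0 by rewrite /w powR0// gt_eqF//; lra.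
  rewrite -ball_intZ//.
  - apply: ball_int_le => //.
    + apply: measurable_funM => //; apply: measurable_funM => //.
      by apply: measurable_funB => //; exact: mSp.
    + apply: measurable_funD; apply: measurable_funM => //.
      exact: measurable_fun_powR.
    + by move=> x _; rewrite w0 subr0 !mulr_ge0 ?powR_ge0//; lra.
    + move=> x _; rewrite w0 subr0 /w.
      have -> : C / 2 = c * (2 * c) `^ (P - 1) by rewrite /C; field.
      exact: powR_young.
  - by apply: measurable_funM => //; apply: measurable_funB => //; exact: mSp.
  - by lra.
  - by move=> x _; rewrite w0 subr0 mulr_ge0 ?powR_ge0.
have mup : measurable_fun setT (fun x => u x `^ P) by exact: measurable_fun_powR.
have C2 : 0 <= C / 2 by lra.
move: H1; rewrite ball_intD//; last 4 first.
- exact: measurable_funM.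
- exact: measurable_funM.
- by move=> x _; rewrite mulr_ge0 ?powR_ge0.
- by move=> x _; rewrite mulr_ge0 ?powR_ge0.
rewrite !ball_intZ//; last 2 first.
- by move=> x _; rewrite powR_ge0.
- by move=> x _; rewrite powR_ge0.
have : (0 <= \int[mu]_(x in ballM x0 g0) (u x `^ P)%:E)%E.
  by apply: ball_int_ge0 => x _; exact: powR_ge0.
(* Absorption requires finiteness: each of the [N] averages is at most the integral of [u] over the
   whole ball divided by the volume of the smaller ball, so [S N] is bounded there by the sum
   [c0]. *)
have : (\int[mu]_(x in ballM x0 g0) (S N x `^ P)%:E)%E \is a fin_num.
  rewrite ge0_fin_numE; last by apply: ball_int_ge0 => x _; exact: powR_ge0.
  pose c0 := \sum_(j < N) (avg u x0 g0 * V g0 / V (g0 - j%:Z)).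
  have a0 : 0 <= avg u x0 g0 by exact: ball_avg_ge0.
  have c00 (j : nat) : 0 <= avg u x0 g0 * V g0 / V (g0 - j%:Z).
    have V0 h : 0 <= V h := ltW (V_gt0 h).
    by apply: divr_ge0; [apply: mulr_ge0; [exact: a0|exact: V0]|exact: V0].
  have Sc x : ballM x0 g0 x -> S N x <= c0.
    move=> xB; apply: runmax_ub => [|j jN]; first by apply: sumr_ge0 => j _.
    apply: (@le_trans _ _ (avg u x0 g0 * V g0 / V (g0 - j%:Z))); last first.
      by rewrite /c0 (bigD1 (Ordinal jN))//= lerDl sumr_ge0.
    rewrite ler_pdivlMr ?(V_gt0 _)// -lee_fin -!ball_avgE//.
    apply: ge0_subset_integral => //; try exact: mball.
    - by apply/measurable_EFinP; exact: measurable_funTS.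
    - by move=> y _; rewrite lee_fin.
    - by rewrite -(ballM_eq xB); apply: subset_ballM; rewrite gerBl.
  apply: (@le_lt_trans _ _ (c0 `^ P * V g0)%:E); last by rewrite ltry.
  rewrite -(ball_int_cst muB x0); apply: ball_int_le => //.
  - by move=> x _; exact: powR_ge0.
  - move=> x /Sc Sx; rewrite ge0_ler_powR ?nnegrE ?(ltW P0)//.
    by apply: sumr_ge0 => j _.
set X := (\int[mu]_(x in _) (S N x `^ P)%:E)%E.
set Y := (\int[mu]_(x in _) (u x `^ P)%:E)%E.
case: X => [X| |]//= _; case: Y => [Y| |]//= Y0.
  rewrite -!EFinM -!EFinD !lee_fin mulrAC; move: (C * Y) => Z; lra.
by move=> _; rewrite gt0_muley// ?lte_fin// leey.
Qed.

End Maximal.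

(** * Functions of bounded mean oscillation and Garsia's inequality *)

Section BMO.
Context {R : realType} {p n : nat}.
Hypothesis p_pr : prime p.
Variable mu : {measure set (QpnM p n) -> \bar R}.
Hypothesis muB : forall (x : QpnM p n) g, mu (ballM x g) = (ballvol R p n g)%:E.
Implicit Types (x y z : QpnM p n) (g h : int) (u v : QpnM p n -> R).
Local Notation V := (ballvol R p n).
Local Notation mball := (measurable_ballM _ _).
Local Notation avg := (ball_avg mu).
Local Notation V_gt0 g := (@ballvol_gt0 R p n p_pr g).

Lemma ler_sqrtrD (s t : R) : 0 <= s -> 0 <= t -> Num.sqrt (s + t) <= Num.sqrt s + Num.sqrt t.
Proof.
move=> s0 t0; rewrite -[leRHS]ger0_norm ?addr_ge0 ?sqrtr_ge0// -sqrtr_sqr ler_wsqrtr//.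
by rewrite sqrrD !sqr_sqrtr// lerD2r lerDl mulrn_wge0// mulr_ge0 ?sqrtr_ge0.
Qed.

Lemma loc_integrable_ge0 u : measurable_fun setT u -> (forall x, 0 <= u x) ->
  (forall x g, \int[mu]_(y in ballM x g) (u y)%:E < +oo)%E -> loc_integrable mu u.
Proof.
move=> mu_ u0 ui; split=> // x g; apply/integrableP; split.
  by apply/measurable_EFinP; exact: measurable_funTS.
by under eq_integral do rewrite gee0_abs ?lee_fin//.
Qed.

Lemma loc_integrable_cst (c : R) : loc_integrable mu (cst c).
Proof.
split=> // x g; apply/integrableP; split => //.
  by apply/measurable_EFinP; exact: measurable_cst.
apply: le_lt_trans (ltry (`|c| * V g)).
by have <- := @ball_int_cst _ _ _ mu muB x g `|c|; exact: lexx.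
Qed.

Lemma loc_integrableB u v : loc_integrable mu u -> loc_integrable mu v ->
  loc_integrable mu (u \- v).
Proof.
move=> lu lv; split; first exact: measurable_funB lu.1 lv.1.
move=> x g; exact: (integrableB mball (lu.2 x g) (lv.2 x g)).
Qed.

Lemma loc_integrable_norm u : loc_integrable mu u -> loc_integrable mu (fun y => `|u y|).
Proof.
move=> lu; split; first exact: measurableT_comp lu.1.
by move=> x g; apply: integrable_norm; exact: lu.2.
Qed.

Variable b : QpnM p n -> R.
Hypothesis lb : loc_integrable mu b.

Let mb : measurable_fun setT b. Proof. by case: lb. Qed.

Lemma loc_integrable_dist c : loc_integrable mu (fun y => `|b y - c|).
Proof. exact/loc_integrable_norm/(loc_integrableB lb)/loc_integrable_cst. Qed.

Lemma ball_avg_dist x g c : `|avg b x g - c| <= avg (fun y => `|b y - c|) x g.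
Proof.
rewrite -(ler_pM2r (V_gt0 g)) -lee_fin -ball_avgE//; last exact: loc_integrable_dist.
have -> : (`|avg b x g - c| * V g)%:E = (`| \int[mu]_(y in ballM x g) ((b y)%:E - c%:E) |)%E.
  rewrite integralB_EFin; last 3 first.
  - exact: mball.
  - exact: lb.2.
  - exact: (loc_integrable_cst c).2.
  rewrite ball_avgE// (ball_int_cst muB) -EFinB -mulrBl abse_EFin normrM.
  by rewrite [ `|V g|]gtr0_norm ?(V_gt0 _).
apply: le_trans (le_abse_integral _ _ _) _.
- exact: mball.
- apply/measurable_EFinP/measurable_funTS; exact: measurable_funB.
- by under eq_integral do rewrite -EFinB abse_EFin.
Qed.

Variable K : R.
Hypothesis K0 : 0 <= K.
Hypothesis bK : forall x g,
  (\int[mu]_(y in ballM x g) (`|b y - avg b x g|)%:E <= (K * V g)%:E)%E.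

(** A ball has p^n times the volume of a ball one level below, so this bounds the mean oscillation
    about the average over the next larger ball. *)
Definition bmo_jump : R := p%:R ^+ n * K.
Local Notation D := bmo_jump.

Lemma bmo_leD : K <= D.
Proof.
rewrite /D ler_peMl//; apply: exprn_ege1.
by rewrite ler1n prime_gt0.
Qed.

Lemma bmo_parent x g :
  (\int[mu]_(y in ballM x g) (`|b y - avg b x (g + 1)|)%:E <= (D * V g)%:E)%E.
Proof.
apply: (@le_trans _ _ (\int[mu]_(y in ballM x (g + 1)) (`|b y - avg b x (g + 1)|)%:E)%E).
  apply: ge0_subset_integral; [exact: mball|exact: mball| |by move=> y _; rewrite lee_fin|].
    by apply/measurable_EFinP/measurable_funTS; exact: (loc_integrable_dist _).1.
  by apply: subset_ballM; rewrite lerDl.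
apply: le_trans (bK _ _) _; rewrite lee_fin (@ballvolD R p n p_pr g 1) expr1.
by rewrite /D mulrA mulrAC [p%:R ^+ n * K]mulrC.
Qed.

(* Square roots make the maximal function of an integrable function integrable. *)
Definition oscmax g0 (c : R) (N : nat) x : R :=
  runmax 0 (fun j => Num.sqrt `|avg b x (g0 - j%:Z) - c|) N.

Lemma oscmax_ge0 g0 c N x : 0 <= oscmax g0 c N x.
Proof. exact: (@runmax_le _ 0 _ 0 N). Qed.

Lemma oscmax_leS g0 c N x : oscmax g0 c N x <= oscmax g0 c N.+1 x.
Proof. exact: runmax_le. Qed.

Lemma lconst_oscmax g0 c N h : (forall i, (i < N)%N -> h <= g0 - i%:Z) ->
  lconst h (oscmax g0 c N).
Proof.
move=> hi; apply: (@lconst_runmax _ _ _ 0 (fun j x => Num.sqrt `|avg b x (g0 - j%:Z) - c|)) => i iN x y xy.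
by rewrite (lconst_le (hi i iN) (@lconst_ball_avg _ _ _ mu b _) xy).
Qed.

Lemma measurable_oscmax_comp (f : R -> R) g0 c N :
  measurable_fun setT (fun x => f (oscmax g0 c N x)).
Proof.
apply: (@measurable_lconst _ _ _ _ (g0 - N%:Z)) => x y xy; congr f; move: x y xy.
by apply: lconst_oscmax => i iN; rewrite lerD2l lerN2 lez_nat ltnW.
Qed.

(* Garsia's conditional bound on the remaining growth of the process [oscmax]. *)
Lemma oscmax_remainder x0 g0 c N j x : c = avg b x0 g0 ->
  (j <= N)%N -> ballM x0 g0 x ->
  (\int[mu]_(y in ballM x (g0 - j%:Z)) (oscmax g0 c N y - oscmax g0 c j y)%:E <=
   ((1 + D) * V (g0 - j%:Z))%:E)%E.
Proof.
move=> cE jN x0x; set h := g0 - j%:Z.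
(* The last average already seen by the running maximum at index [j], or the reference value [c] if
   [j = 0]. Thus [|c' - c|] is accounted for at that index, while [|b - c'|] still has mean at most
   [D] on the ball of level [h]. *)
pose c' := if j is j'.+1 then avg b x (g0 - j'%:Z) else c.
have c'A y : ballM x h y -> Num.sqrt `|c' - c| <= oscmax g0 c j y.
  move=> xy; rewrite /c'; case: j jN @h xy @c' => [|j'] jN /= xy.
    by rewrite subrr normr0 sqrtr0 oscmax_ge0.
  have -> : avg b x (g0 - j'%:Z) = avg b y (g0 - j'%:Z).
    rewrite /ball_avg; congr (_ * fine _); congr (\int[mu]_(_ in _) _)%E.
    by apply/esym; apply: ballM_eqW xy; rewrite lerD2l lerN2 lez_nat.
  exact: (@runmax_ge _ 0 (fun i => Num.sqrt `|avg b y (g0 - i%:Z) - c|) j').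
have c'D : (\int[mu]_(y in ballM x h) (`|b y - c'|)%:E <= (D * V h)%:E)%E.
  rewrite /c' /h; clear c'A; case: j jN @h @c' => [|j'] jN /=.
    rewrite subr0; apply: le_trans (_ : (K * V g0)%:E <= _)%E; last first.
      by rewrite lee_fin ler_wpM2r ?bmo_leD ?(ltW (V_gt0 _)).
    apply: le_trans (bK x g0); rewrite cE.
    by rewrite (lconst_ball_avg mu b x0x).
  have -> : g0 - j'%:Z = (g0 - j'.+1%:Z) + 1 by lia.
  exact: bmo_parent.
pose u y := `|b y - c'|.
have lu : loc_integrable mu u by exact: loc_integrable_dist.
have u0 y : 0 <= u y by exact: normr_ge0.
(* A later average differs from [c] by at most [|c' - c|] plus the average of [|b - c'|]. As the
   square root is subadditive, the excess over index [j] is at most the square root of the maximal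
   function of [u] restarted at level [h]. *)
apply: le_trans (sqrt_avgmax_int p_pr muB (N - j) lu u0 c'D).
apply: ball_int_le.
- by apply: measurable_funB; exact: (measurable_oscmax_comp id).
- exact: measurable_avgmax_comp.
- move=> y _; rewrite subr_ge0.
  exact: runmax_le.
move=> y xy; rewrite lerBlDl; apply: runmax_ub => [|i iN].
  by rewrite addr_ge0 ?oscmax_ge0 ?sqrtr_ge0.
have [ij|ji] := ltnP i j.
  rewrite -[leLHS]addr0 lerD ?sqrtr_ge0//.
  exact: (@runmax_ge _ 0 (fun i => Num.sqrt `|avg b y (g0 - i%:Z) - c|) i).
apply: (@le_trans _ _ (Num.sqrt `|c' - c| + Num.sqrt (avg u y (g0 - i%:Z)))).
  apply: (@le_trans _ _ (Num.sqrt (`|c' - c| + avg u y (g0 - i%:Z)))).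
    apply: ler_wsqrtr; rewrite [leRHS]addrC; apply: le_trans (_ : `|avg b y (g0 - i%:Z) - c'| + `|c' - c| <= _).
      exact: ler_distD.
    by rewrite lerD2r; exact: ball_avg_dist.
  have a0 : 0 <= avg u y (g0 - i%:Z) by apply: ball_avg_ge0 => // z; exact: normr_ge0.
  exact: ler_sqrtrD.
apply: lerD; first exact: c'A.
apply: ler_wsqrtr; rewrite /avgmax.
have -> : g0 - i%:Z = h - (i - j)%N%:Z by rewrite /h; lia.
by apply: (@runmax_ge _ 1 (fun k => avg u y (h - k%:Z)) (i - j)); lia.
Qed.

Lemma exprn_increment (s t : R) (k : nat) : 0 <= s -> s <= t ->
  t ^+ k.+1 - s ^+ k.+1 <= k.+1%:R * (t ^+ k * (t - s)).
Proof.
move=> s0 st; have t0 : 0 <= t by lra.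
suff : 0 <= k%:R * t ^+ k.+1 + s ^+ k.+1 - k.+1%:R * s * t ^+ k.
  by rewrite !exprS -!natr1; lra.
elim: k => [|k IH]; first by rewrite !expr1 expr0; lra.
have -> : k.+1%:R * t ^+ k.+2 + s ^+ k.+2 - k.+2%:R * s * t ^+ k.+1 =
  t * (k%:R * t ^+ k.+1 + s ^+ k.+1 - k.+1%:R * s * t ^+ k) +
  (t - s) * (t ^+ k.+1 - s ^+ k.+1) by rewrite -!natr1 !exprS; ring.
by apply: addr_ge0; apply: mulr_ge0 => //; rewrite subr_ge0// lerXn2r ?nnegrE.
Qed.

(** Summation by parts turns the sum into that of [a j.+1 ^ k.+1] times the steps of [a], which
    dominates the increments of [a ^ k.+2] up to the factor [k.+2]. The point of the form is the
    remaining growth [a N - a j], which [oscmax_remainder] controls. *)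
Lemma garsia_abel (a : nat -> R) (k N : nat) : a 0%N = 0 ->
  (forall i, a i <= a i.+1) ->
  a N ^+ k.+2 <= k.+2%:R * \sum_(j < N) (a j.+1 ^+ k.+1 - a j ^+ k.+1) * (a N - a j).
Proof.
move=> a0 aS; have aN i : 0 <= a i by elim: i => [|i IH]; [rewrite a0|exact: le_trans (aS i)].
have tel f M : f 0%N = 0 -> f M = \sum_(j < M) (f j.+1 - f j) :> R.
  by move=> f0; rewrite -(big_mkord xpredT (fun j => f j.+1 - f j)) telescope_sumr// f0 subr0.
have -> : \sum_(j < N) (a j.+1 ^+ k.+1 - a j ^+ k.+1) * (a N - a j) =
    \sum_(j < N) (a j.+1 ^+ k.+1 * (a j.+1 - a j)).
  elim: N => [|N IH]; first by rewrite !big_ord0.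
  rewrite big_ord_recr/= [RHS]big_ord_recr/= -IH.
  have -> : \sum_(j < N) (a j.+1 ^+ k.+1 - a j ^+ k.+1) * (a N.+1 - a j) =
      \sum_(j < N) (a j.+1 ^+ k.+1 - a j ^+ k.+1) * (a N - a j) +
      a N ^+ k.+1 * (a N.+1 - a N).
    rewrite [X in X * _](tel (fun j => a j ^+ k.+1)) ?a0 ?expr0n//.
    by rewrite mulr_suml -big_split/=; apply: eq_bigr => j _; ring.
  by ring.
rewrite (tel (fun j => a j ^+ k.+2)) ?a0 ?expr0n// mulr_sumr.
by apply: ler_sum => j _; exact: exprn_increment.
Qed.

(** Induction on the exponent. The weights in [garsia_abel] are constant on balls of level [g0 - j],
    so each remaining growth may be replaced by its mean bound [1 + D]; the weights then telescope
    to the previous power. Every step costs a factor [k.+2 (1 + D)]. *)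
Lemma garsia x0 g0 c N k : c = avg b x0 g0 ->
  (\int[mu]_(y in ballM x0 g0) (oscmax g0 c N y ^+ k)%:E <=
   (k`!%:R * (1 + D) ^+ k * V g0)%:E)%E.
Proof.
move=> cE; set A := oscmax g0 c.
have D0 : 0 <= D by apply: le_trans bmo_leD.
have mA j l : measurable_fun setT (fun y => A j y ^+ l).
  exact: (@measurable_oscmax_comp (fun t => t ^+ l)).
have AB j : measurable_fun setT (fun y => A N y - A j y).
  by apply: measurable_funB; exact: (measurable_oscmax_comp id).
have AN j y : (j <= N)%N -> A j y <= A N y by exact: runmax_le.
case: k => [|k].
  under eq_integral do rewrite expr0.
  by rewrite (ball_int_cst muB) fact0 expr0 !mul1r.
elim: k => [|k IH].
  rewrite (_ : 1`! = 1%N)// mul1r expr1.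
  have := @oscmax_remainder x0 g0 c N 0 x0 cE (leq0n _) (@ballM_refl _ _ x0 g0).
  rewrite /= subr0; apply: le_trans.
  apply: ball_int_le => // y _; first exact/exprn_ge0/oscmax_ge0.
  by rewrite expr1 [oscmax g0 c 0 y]/oscmax/= subr0.
have dA j y : 0 <= A j.+1 y ^+ k.+1 - A j y ^+ k.+1.
  by rewrite subr_ge0 lerXn2r ?nnegrE ?oscmax_ge0 ?oscmax_leS.
have mdA j : measurable_fun setT (fun y => A j.+1 y ^+ k.+1 - A j y ^+ k.+1).
  exact: measurable_funB.
(* The maximum with 0 changes nothing for [j <= N]; it keeps [F] nonnegative at all indices, as
   [ball_int_sum] asks. *)
pose F j y := (A j.+1 y ^+ k.+1 - A j y ^+ k.+1) * Num.max 0 (A N y - A j y).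
have mmax j : measurable_fun setT (fun y => Num.max 0 (A N y - A j y)).
  exact: measurable_maxr.
have F0 j y : 0 <= F j y by rewrite mulr_ge0// le_max lexx.
have mF j : measurable_fun setT (F j) by exact: measurable_funM.
have cD : 0 <= 1 + D by lra.
apply: (@le_trans _ _ (k.+2%:R%:E * \int[mu]_(y in ballM x0 g0) (\sum_(j < N) F j y)%:E)%E).
  rewrite -ball_intZ//; last 2 first.
  - by apply: measurable_sum.
  - by move=> y _; apply: sumr_ge0.
  apply: ball_int_le => // [|y _|y _].
  - by apply: measurable_funM => //; apply: measurable_sum.
  - by rewrite exprn_ge0// oscmax_ge0.
  - apply: le_trans (@garsia_abel (A ^~ y) k N _ _) _ => //.
    + by move=> i; exact: oscmax_leS.
    + rewrite ler_wpM2l//; apply: ler_sum => j _.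
      by rewrite ler_wpM2l// le_max lexx orbT.
rewrite ball_int_sum//.
apply: (@le_trans _ _ (k.+2%:R%:E * \sum_(j < N) \int[mu]_(y in ballM x0 g0)
    ((1 + D) * (A j.+1 y ^+ k.+1 - A j y ^+ k.+1))%:E)%E).
  rewrite lee_wpmul2l ?lee_fin//; apply: lee_sum => j _.
  under [leRHS]eq_integral do rewrite mulrC EFinM.
  under [leLHS]eq_integral do rewrite /F EFinM.
  apply: (@integral_lconst_le R p n mu x0 g0 (g0 - j%:Z) _
    (fun y => (Num.max 0 (A N y - A j y))%:E) (cst (1 + D)%:E)) => //.
  - by rewrite gerBl.
  - have H l : (l <= j.+1)%N -> lconst (g0 - j%:Z) (A l).
      by move=> lj; apply: lconst_oscmax => i il; rewrite lerD2l lerN2 lez_nat; lia.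
    by move=> x y xy; rewrite (H j.+1 _ x y)// (H j _ x y).
  - exact/measurable_EFinP.
  - by move=> y; rewrite lee_fin le_max lexx.
  - move=> x x0x; rewrite (ball_int_cst muB).
    apply: le_trans (oscmax_remainder cE (ltnW (ltn_ord j)) x0x).
    apply: ball_int_le => // [y _|y _]; first by rewrite le_max lexx.
    by rewrite ge_max subr_ge0 lexx andbT AN// ltnW.
rewrite -(@ball_int_sum _ _ _ _ _ _ _ (fun j y => (1 + D) * (A j.+1 y ^+ k.+1 - A j y ^+ k.+1))); last 2 first.
- by move=> j; apply: measurable_funM.
- by move=> j y; rewrite mulr_ge0.
rewrite (eq_integral (fun y => ((1 + D) * A N y ^+ k.+1)%:E)); last first.
  move=> y _; congr EFin; rewrite -mulr_sumr; congr (_ * _).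
  rewrite -(big_mkord xpredT (fun j => A j.+1 y ^+ k.+1 - A j y ^+ k.+1)) telescope_sumr//.
  by rewrite /A /oscmax/= expr0n subr0.
rewrite ball_intZ//; last by move=> y _; rewrite exprn_ge0// oscmax_ge0.
rewrite muleA -EFinM.
apply: le_trans (lee_wpmul2l _ IH) _; first by rewrite lee_fin mulr_ge0.
rewrite -EFinM lee_fin le_eqVlt; apply/orP; left; apply/eqP.
by rewrite [in RHS]factS [in RHS]natrM [in RHS]exprS; ring.
Qed.

End BMO.

(** * Density of locally constant functions in the integrable functions on a ball *)

Section Density.
Context {R : realType} {p n : nat}.
Hypothesis p_pr : prime p.
Variable mu : {measure set (QpnM p n) -> \bar R}.
Hypothesis muB : forall (x : QpnM p n) g, mu (ballM x g) = (ballvol R p n g)%:E.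
Implicit Types (x y z : QpnM p n) (g h : int) (u v : QpnM p n -> R).
Local Notation V := (ballvol R p n).
Local Notation mball := (measurable_ballM _ _).
Local Notation avg := (ball_avg mu).
Local Notation V_gt0 g := (@ballvol_gt0 R p n p_pr g).

(** Monotone convergence, packaged so that a bound uniform in the truncation passes to anything
    below the supremum of the truncations. *)
Lemma integral_sup_le x0 g0 (f : nat -> QpnM p n -> \bar R) (F : QpnM p n -> \bar R) (M : \bar R) :
  (forall k, measurable_fun setT (f k)) -> measurable_fun setT F ->
  (forall k y, 0 <= f k y)%E -> (forall y, 0 <= F y)%E ->
  (forall y, {homo f ^~ y : i j / (i <= j)%N >-> (i <= j)%E}) ->
  (forall y, ballM x0 g0 y -> F y <= ereal_sup (range (f ^~ y)))%E ->
  (forall k, \int[mu]_(y in ballM x0 g0) f k y <= M)%E ->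
  (\int[mu]_(y in ballM x0 g0) F y <= M)%E.
Proof.
move=> mf mF f0 F0 fh Fs fM.
have fcv y : cvgn (f ^~ y) by apply: ereal_nondecreasing_is_cvgn => i j; exact: fh.
apply: (@le_trans _ _ (\int[mu]_(y in ballM x0 g0) limn (f ^~ y))%E).
  apply: ge0_le_integral => //; first exact: mball.
  - exact: measurable_funTS.
  - apply: measurable_funTS; apply: emeasurable_fun_cvg mf _ => y _.
    exact: fcv.
  - move=> y /Fs/le_trans; apply.
    by rewrite (cvg_lim _ (ereal_nondecreasing_cvgn (fh y))).
rewrite monotone_convergence//; first last.
- by move=> k; exact: measurable_funTS.
- exact: mball.
apply: lime_le; last by apply: nearW => k; exact: fM.
apply: ereal_nondecreasing_is_cvgn => i j ij; apply: ge0_le_integral => //; first exact: mball.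
- exact: measurable_funTS.
- exact: measurable_funTS.
- by move=> y _; exact: fh.
Qed.

Lemma cvge0_le (f : nat -> \bar R) (e : R) : 0 < e -> (forall k, 0 <= f k)%E ->
  f @ \oo --> (0 : \bar R)%E -> exists k, (f k <= e%:E)%E.
Proof.
move=> e0 f0 /fine_cvgP[[k1 _ fin]] /cvgr0Pnorm_le/(_ _ e0)[k2 _ le_e].
exists (maxn k1 k2); rewrite -(@fineK _ (f _)) ?fin//= ?leq_maxl//.
by rewrite lee_fin (le_trans (ler_norm _))// le_e//= leq_maxr.
Qed.

Variables (x0 : QpnM p n) (g0 : int).
Local Notation B0 := (ballM x0 g0).

Definition lconst_approx u := forall e : R, 0 < e -> exists h v,
  lconst h v /\ (\int[mu]_(y in B0) (`|u y - v y|)%:E <= e%:E)%E.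

Lemma lconst_lconst_approx h u : lconst h u -> lconst_approx u.
Proof.
move=> uc e e0; exists h, u; split=> //.
rewrite (eq_integral (cst 0%E)) ?integral0 ?lee_fin ?ltW// => y _.
by rewrite subrr normr0.
Qed.

Lemma lconst_approx_trans u : measurable_fun setT u ->
  (forall e : R, 0 < e -> exists u', [/\ measurable_fun setT u', lconst_approx u' &
    (\int[mu]_(y in B0) (`|u y - u' y|)%:E <= e%:E)%E]) -> lconst_approx u.
Proof.
move=> mu_ H e e0; have e20 : 0 < e / 2 by lra.
have [u' [mu' au' uu']] := H _ e20; have [h [v [vc uv]]] := au' _ e20.
have mv := measurable_lconst vc.
exists h, v; split=> //; rewrite (splitr e) EFinD; apply: le_trans (leeD uu' uv).
rewrite -ball_intD//.
- apply: ball_int_le => //; last by move=> y _; exact: ler_distD.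
  + by apply: measurableT_comp => //; exact: measurable_funB.
  + by apply: measurable_funD; apply: measurableT_comp => //; exact: measurable_funB.
- by apply: measurableT_comp => //; exact: measurable_funB.
- by apply: measurableT_comp => //; exact: measurable_funB.
Qed.

(** A Lipschitz operation applied to two approximants is constant at the finer of their levels. It
    will serve with a difference, a maximum and a linear combination. *)
Lemma lconst_approx_op (F : R -> R -> R) (k : R) u u' : 0 < k ->
  (forall a b c d, `|F a b - F c d| <= k * (`|a - c| + `|b - d|)) ->
  measurable_fun setT u -> measurable_fun setT u' ->
  measurable_fun setT (fun y => F (u y) (u' y)) ->
  lconst_approx u -> lconst_approx u' -> lconst_approx (fun y => F (u y) (u' y)).
Proof.
move=> k0 Fk mu1 mu2 mF a1 a2 e e0; have e20 : 0 < e / k / 2 by rewrite !divr_gt0.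
have [h1 [v1 [c1 uv1]]] := a1 _ e20; have [h2 [v2 [c2 uv2]]] := a2 _ e20.
pose h := Num.min h1 h2; have c1' := @lconst_le _ _ _ h1 h v1 _ c1.
have c2' := @lconst_le _ _ _ h2 h v2 _ c2.
have cF : lconst h (fun y => F (v1 y) (v2 y)).
  by move=> x y xy; rewrite (c1' _ x y)// ?(c2' _ x y)// ge_min lexx ?orbT.
have mv1 := measurable_lconst c1; have mv2 := measurable_lconst c2.
have md u1 u2 : measurable_fun setT u1 -> measurable_fun setT u2 ->
    measurable_fun setT (fun y => `|u1 y - u2 y|).
  by move=> m1 m2; apply: measurableT_comp => //; exact: measurable_funB.
exists h, (fun y => F (v1 y) (v2 y)); split => //.
apply: (@le_trans _ _ (\int[mu]_(y in B0) (k * (`|u y - v1 y| + `|u' y - v2 y|))%:E)%E).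
  apply: ball_int_le => //.
  - by apply: md => //; exact: measurable_lconst cF.
  - by apply: measurable_funM => //; apply: measurable_funD; exact: md.
have k0' := ltW k0; rewrite ball_intZ//; last by apply: measurable_funD; exact: md.
rewrite ball_intD//; [|exact: md|exact: md].
apply: le_trans (lee_wpmul2l _ (leeD uv1 uv2)) _; first by rewrite lee_fin ltW.
by rewrite -EFinD -EFinM lee_fin -splitr mulrC divfK ?gt_eqF.
Qed.

(** The sets with this property form a sigma-algebra containing the balls: complements are
    [1 - \1_A], finite unions are maxima, and countable unions are limits of finite ones. *)
Lemma lconst_approx_indic (A : set (QpnM p n)) : measurable A -> lconst_approx \1_A.
Proof.
move: A; pose G := [set A : set (QpnM p n) | measurable A /\ lconst_approx \1_A].
suff : sigma_algebra setT G.
  move=> sG; suff : <<s pballs p n >> `<=` G by move=> H A mA; exact: (H A mA).2.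
  apply: smallest_sub => // _ [x [g ->]]; split; first exact: (measurable_ballM x g).
  apply: (@lconst_lconst_approx g) => y z yz; rewrite !indicE; congr (_%:R).
  congr nat_of_bool; apply/idP/idP; rewrite !inE => /= /ballM_eq E; rewrite -[pball x g]/(ballM x g) -E.
    by apply: ballM_sym.
  exact: yz.
split.
- split => //; rewrite indic0; exact: (@lconst_lconst_approx 0).
- move=> A [mA aA]; split; first exact: measurableD.
  have -> : \1_(setT `\` A) = (fun y => (cst 1 : QpnM p n -> R) y - \1_A y).
    by apply/funext => y; rewrite !indicE in_setD in_setT; case: (_ \in _); rewrite /= ?subr0 ?subrr.
  apply: (@lconst_approx_op (fun a b => a - b) 1 (cst 1) \1_A) => //.
  + move=> a b c d; rewrite /= mul1r (_ : a - b - (c - d) = (a - c) - (b - d)); first exact: ler_normB.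
    by ring.
  + by apply: measurable_funB => //; exact: measurable_indic.
  + exact: (@lconst_lconst_approx 0).
- move=> A GA; pose U k := \big[setU/set0]_(i < k) A i.
  have mU k : measurable (U k) by apply: bigsetU_measurable => i _; exact: (GA i).1.
  have mA : measurable (\bigcup_k A k) by apply: bigcup_measurable => k _; exact: (GA k).1.
  have aU k : lconst_approx \1_(U k).
    elim: k => [|k IH]; first by rewrite /U big_ord0 indic0; exact: (@lconst_lconst_approx 0).
    have -> : \1_(U k.+1) = (fun y => Num.max (\1_(U k) y : R) (\1_(A k) y)).
      apply/funext => y; rewrite /U big_ord_recr/= !indicE in_setU.
      by case: (_ \in _); case: (_ \in _); rewrite /= ?mulr1n ?mulr0n maxEle ?lexx ?ler01 ?ler10.
    apply: (@lconst_approx_op (fun a b => Num.max a b) 1 \1_(U k) \1_(A k)) => //; first last.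
    + exact: (GA k).2.
    + by apply: measurable_maxr => //; apply: measurable_indic => //; exact: (GA k).1.
    + by apply: measurable_indic; exact: (GA k).1.
    + move=> a b c d; rewrite mul1r ler_norml.
      have := ler_norm (a - c); have := ler_norm (b - d).
      have := ler_norm (c - a); have := ler_norm (d - b).
      rewrite (distrC c) (distrC d) => *.
      by rewrite !maxEle; case: ifP => ?; case: ifP => ?; apply/andP; split; lra.
  split => //; apply: lconst_approx_trans => [|e e0]; first exact: measurable_indic.
  (* What the first [k] sets miss inside the ball decreases to the empty set; as the ball has finite
     measure, the measure of the missing part tends to 0. *)
  pose F k := B0 `&` (\bigcup_k A k `\` U k).
  have mF k : measurable (F k) by apply: measurableI; [exact: mball|exact: measurableD].
  have F0 : \bigcap_k F k = set0.
    apply/seteqP; split => // y yF; have [_ [[k _ Aky] _]] := yF 0%N Logic.I.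
    have [_ [_ []]] := yF k.+1 Logic.I.
    by rewrite /U -bigcup_mkord; exists k => /=.
  have cF : mu \o F @ \oo --> mu (\bigcap_k F k).
    apply: nonincreasing_cvg_mu => //; last 2 first.
    - by rewrite F0.
    - move=> i j ij; apply/subsetPset; apply: setIS; apply: setDS.
      exact: subset_bigsetU.
    apply: le_lt_trans (ltry (V g0)); rewrite -(muB x0); apply: le_measure; rewrite ?inE//.
      exact: mball.
    by move=> y [].
  rewrite F0 measure0 in cF.
  have [k Fk] := cvge0_le e0 (fun k => measure_ge0 mu (F k)) cF.
  exists \1_(U k); split => //.
  have Ek : (\int[mu]_(y in B0) (\1_(\bigcup_k A k `\` U k) y)%:E = mu (F k))%E.
    by rewrite integral_indic 1?setIC//; [exact: mball|exact: measurableD].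
  apply: le_trans (_ : _ <= mu (F k))%E Fk; rewrite -Ek.
  rewrite le_eqVlt; apply/orP; left; apply/eqP; apply: eq_integral => y _; congr EFin.
  rewrite !indicE in_setD.
  have [yU|yU] := boolP (y \in U k).
    have -> : y \in \bigcup_k A k.
      by move: yU; rewrite !inE /U -bigcup_mkord => -[i _ Aiy]; exists i.
    by rewrite subrr normr0.
  by rewrite subr0 andbT normr_nat.
Qed.

Import HBSimple.

Lemma lconst_approx_integrable u : measurable_fun setT u ->
  mu.-integrable B0 (EFin \o u) -> lconst_approx u.
Proof.
move=> mu_ /(@approximation_sfun_integrable _ _ _ mu _ mball)[f [fint _ fcv]].
apply: lconst_approx_trans => // e e0.
have [k fk] := cvge0_le e0 (fun k => integral_ge0 _ (fun y _ => abse_ge0 _)) fcv.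
exists (fun y => f k y); split => //.
have -> : (fun y => f k y) = fun y => \sum_(c <- finmap.enum_fset (fset_set (range (f k)))) c * \1_(f k @^-1` [set c]) y.
  by apply/funext => y; rewrite fimfunE fsbig_finite//; exact: fimfunP.
elim: (finmap.enum_fset _) => [|c s IH].
  apply: (@lconst_lconst_approx 0) => y z _; by rewrite !big_nil.
have mi c' : measurable_fun setT (\1_(f k @^-1` [set c']) : QpnM p n -> R) by exact: measurable_indic.
have mt : measurable_fun setT (fun y => \sum_(c <- s) c * \1_(f k @^-1` [set c]) y).
  by apply: measurable_sum => c'; exact: measurable_funM.
have -> : (fun y => \sum_(c <- c :: s) c * \1_(f k @^-1` [set c]) y) =
   (fun y => c * \1_(f k @^-1` [set c]) y + \sum_(c <- s) c * \1_(f k @^-1` [set c]) y).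
  by apply/funext => y; rewrite big_cons.
apply: (@lconst_approx_op (fun a b => c * a + b) (1 + `|c|)
  \1_(f k @^-1` [set c]) (fun y => \sum_(c <- s) c * \1_(f k @^-1` [set c]) y)) => //.
- move=> a b a' b'; rewrite opprD addrACA -mulrBr (le_trans (ler_normD _ _))//.
  rewrite normrM; have := normr_ge0 (a - a'); have := normr_ge0 (b - b'); have := normr_ge0 c.
  by move=> *; nra.
- by apply: measurable_funD => //; exact: measurable_funM.
- exact: lconst_approx_indic.
Qed.

End Density.

(** * The John-Nirenberg inequality for integer exponents *)

Section JohnNirenberg.
Context {R : realType} {p n : nat}.
Hypothesis p_pr : prime p.
Variable mu : {measure set (QpnM p n) -> \bar R}.
Hypothesis muB : forall (x : QpnM p n) g, mu (ballM x g) = (ballvol R p n g)%:E.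
Implicit Types (x y z : QpnM p n) (g h : int) (u v : QpnM p n -> R).
Local Notation V := (ballvol R p n).
Local Notation mball := (measurable_ballM _ _).
Local Notation avg := (ball_avg mu).
Local Notation V_gt0 g := (@ballvol_gt0 R p n p_pr g).

Variable b : QpnM p n -> R.
Hypothesis lb : loc_integrable mu b.

Let mb : measurable_fun setT b. Proof. by case: lb. Qed.

Lemma measurable_avg_comp (f : R -> R) g : measurable_fun setT (fun x => f (avg b x g)).
Proof.
by apply: (@measurable_lconst _ _ _ _ g) => x y xy; rewrite (lconst_ball_avg mu b xy).
Qed.

(** An integrated form of Lebesgue's differentiation theorem. If [v] is constant on balls of level
    [g], the averages of [b] at that level are no farther from [v] in mean than [b] is, so the error
    is at most twice that of [v]. *)
Lemma avg_approx x0 g0 (e : R) : 0 < e -> exists N : nat,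
  (\int[mu]_(y in ballM x0 g0) (`|b y - avg b y (g0 - N%:Z)|)%:E <= e%:E)%E.
Proof.
move=> e0; have e20 : 0 < e / 2 by lra.
have [h [v [vh bv]]] := lconst_approx_integrable muB mb (lb.2 x0 g0) e20.
(* If [h] is above [g0], then [g] lies below both; in either case [g <= h], so [v] stays constant on
   [g]-balls. *)
pose N := `|g0 - h|%N; set g := g0 - N%:Z.
have vc : lconst g v by apply: lconst_le vh; rewrite /g /N; lia.
have mv := measurable_lconst vc.
have mbv : measurable_fun setT (fun y => `|b y - v y|).
  by apply: measurableT_comp => //; exact: measurable_funB.
have mva : measurable_fun setT (fun y => `|v y - avg b y g|).
  apply: (@measurable_lconst _ _ _ _ g) => x y xy.
  by rewrite (lconst_ball_avg mu b xy) (vc x y).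
exists N; rewrite -/g.
apply: (@le_trans _ _ (\int[mu]_(y in ballM x0 g0) (`|b y - v y| + `|v y - avg b y g|)%:E)%E).
  apply: ball_int_le => //; last by move=> y _; exact: ler_distD.
  - by apply: measurableT_comp => //; apply: measurable_funB => //; exact: (measurable_avg_comp id).
  - exact: measurable_funD.
rewrite ball_intD// (splitr e) EFinD; apply: leeD => //; apply: le_trans bv.
have E (w : QpnM p n -> \bar R) : (\int[mu]_(y in ballM x0 g0) w y =
    \int[mu]_(y in ballM x0 g0) ((cst 1%R y)%:E * w y))%E.
  by apply: eq_integral => y _; rewrite mul1e.
rewrite E [leRHS]E; apply: (@integral_lconst_le R p n mu x0 g0 g) => //.
- by rewrite gerBl.
- exact/measurable_EFinP.
- exact/measurable_EFinP.
- move=> x _.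
  rewrite (eq_integral (cst (`|avg b x g - v x|)%:E)); last first.
    by move=> y; rewrite inE => xy; rewrite (lconst_ball_avg mu b xy) (vc x y)// distrC.
  rewrite [in leRHS](eq_integral (fun y => (`|b y - v x|)%:E)); last first.
    by move=> y; rewrite inE => xy; rewrite (vc x y).
  rewrite (ball_int_cst muB) (ball_avgE p_pr (loc_integrable_dist muB lb _)) lee_fin.
  by rewrite ler_pM2r ?(V_gt0 _)// (ball_avg_dist p_pr muB lb).
Qed.

Variable K : R.
Hypothesis K0 : 0 <= K.
Hypothesis bK : forall x g,
  (\int[mu]_(y in ballM x g) (`|b y - avg b x g|)%:E <= (K * V g)%:E)%E.

(** The exponent is doubled because [oscmax] is built from square roots: a moment of order [t] of
    [|b - c|] corresponds to one of order [2t] of [oscmax]. *)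
Definition jn_const (t : nat) : R := (t.*2)`!%:R * (1 + @bmo_jump R p n K) ^+ t.*2.

Lemma jn_const_ge0 t : 0 <= jn_const t.
Proof.
rewrite mulr_ge0// exprn_ge0// addr_ge0//.
by apply: le_trans K0 _; exact: bmo_leD.
Qed.

Lemma avg_dist_oscmax g0 c (N j : nat) x : (j < N)%N ->
  `|avg b x (g0 - j%:Z) - c| <= oscmax mu b g0 c N x ^+ 2.
Proof.
move=> jN; rewrite -[leLHS]sqr_sqrtr// lerXn2r ?nnegrE ?sqrtr_ge0 ?oscmax_ge0//.
exact: (@runmax_ge _ 0 (fun i => Num.sqrt `|avg b x (g0 - i%:Z) - c|) j).
Qed.

Lemma oscmax_moment x0 g0 N t :
  (\int[mu]_(y in ballM x0 g0) ((oscmax mu b g0 (avg b x0 g0) N y ^+ 2) ^+ t)%:E <=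
   (jn_const t * V g0)%:E)%E.
Proof.
under eq_integral do rewrite -exprM mul2n.
exact: garsia.
Qed.

Lemma expr_lipschitz (s r T : R) (t : nat) : 0 <= s <= T -> 0 <= r <= T ->
  s ^+ t.+1 <= r ^+ t.+1 + t.+1%:R * T ^+ t * `|s - r|.
Proof.
move=> /andP[s0 sT] /andP[r0 rT]; have [sr|rs] := leP s r.
  have : s ^+ t.+1 <= r ^+ t.+1 by rewrite lerXn2r ?nnegrE.
  have : 0 <= t.+1%:R * T ^+ t * `|s - r| by rewrite !mulr_ge0 ?exprn_ge0// (le_trans s0).
  lra.
rewrite addrC -lerBlDr; apply: le_trans (exprn_increment _ r0 (ltW rs)) _.
rewrite -mulrA ler_wpM2l// gtr0_norm ?subr_gt0// ler_wpM2r ?subr_ge0 ?(ltW rs)//.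
by rewrite lerXn2r ?nnegrE// (le_trans s0).
Qed.

(** For the function truncated at height [k] the power is Lipschitz, so [b] may be replaced by its
    averages at a fine level at the cost of an arbitrarily small [e]. Those averages are dominated
    by [oscmax ^ 2], whose moments come from [garsia]; then [k] tends to infinity. *)
Lemma john_nirenberg x0 g0 t :
  (\int[mu]_(y in ballM x0 g0) (`|b y - avg b x0 g0| ^+ t)%:E <= (jn_const t * V g0)%:E)%E.
Proof.
set c := avg b x0 g0.
have mbc : measurable_fun setT (fun y => `|b y - c|) by exact: (loc_integrable_dist muB lb c).1.
have mmin (T : R) k : measurable_fun setT (fun y => Num.min `|b y - c| T ^+ k).
  by apply: measurable_funX; exact: measurable_minr.
case: t => [|t].
  under eq_integral do rewrite expr0.
  by rewrite (ball_int_cst muB) /jn_const double0 fact0 expr0 !mul1r.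
pose f k y := (Num.min `|b y - c| k%:R ^+ t.+1)%:E.
apply: (@integral_sup_le _ _ _ mu x0 g0 f) => //.
- by move=> k; apply/measurable_EFinP.
- by apply/measurable_EFinP; exact: measurable_funX.
- by move=> k y; rewrite lee_fin exprn_ge0// le_min normr_ge0 ler0n.
- move=> y i j ij; rewrite lee_fin lerXn2r ?nnegrE ?le_min ?normr_ge0 ?ler0n//.
  by rewrite !ge_min lexx /= ler_nat ij orbT.
- move=> y _; apply: ereal_sup_ubound; exists (Num.truncn `|b y - c|).+1 => //.
  by rewrite /f min_l// ltW// truncnS_gt.
move=> k; apply/lee_addgt0Pr => e e0.
pose T : R := k%:R; pose L := t.+1%:R * T ^+ t.
have L0 : 0 <= L by rewrite mulr_ge0// exprn_ge0.
(* This makes [L] times the error at most [e], including when [L = 0]. *)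
have e1 : 0 < e / (L + 1) by rewrite divr_gt0// ltr_wpDl.
have [N bN] := avg_approx x0 g0 e1.
have mbN : measurable_fun setT (fun y => `|b y - avg b y (g0 - N%:Z)|).
  by apply: measurableT_comp => //; apply: measurable_funB => //; exact: (measurable_avg_comp id).
have mosc : measurable_fun setT (fun y => (oscmax mu b g0 c N.+1 y ^+ 2) ^+ t.+1).
  exact: (@measurable_oscmax_comp _ _ _ mu b (fun a => (a ^+ 2) ^+ t.+1)).
(* Index [N.+1] is the first at which the average of level [g0 - N] has entered [oscmax]. *)
apply: (@le_trans _ _ (\int[mu]_(y in ballM x0 g0)
    ((oscmax mu b g0 c N.+1 y ^+ 2) ^+ t.+1 + L * `|b y - avg b y (g0 - N%:Z)|)%:E)%E).
  apply: ball_int_le => //.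
  - by apply: measurable_funD => //; exact: measurable_funM.
  - move=> y _; set a := `|avg b y (g0 - N%:Z) - c|.
    have := @expr_lipschitz (Num.min `|b y - c| T) (Num.min a T) T t.
    rewrite !le_min !ge_min !normr_ge0 ler0n !lexx !orbT => /(_ isT isT)/le_trans; apply.
    apply: lerD.
      apply: lerXn2r; rewrite ?nnegrE ?le_min ?normr_ge0 ?ler0n ?exprn_ge0 ?oscmax_ge0//.
      by rewrite ge_min avg_dist_oscmax.
    rewrite ler_wpM2l//.
    have : `| `|b y - c| - a | <= `|b y - avg b y (g0 - N%:Z)|.
      rewrite /a (_ : b y - avg b y (g0 - N%:Z) = (b y - c) - (avg b y (g0 - N%:Z) - c)).
        exact: ler_dist_dist.
      by ring.
    apply: le_trans; rewrite ler_norml.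
    have := ler_norm (`|b y - c| - a); have := ler_norm (a - `|b y - c|).
    rewrite (distrC a); have := normr_ge0 (`|b y - c| - a).
    by rewrite !minEle => *; case: ifP => ?; case: ifP => ?; apply/andP; split; lra.
rewrite ball_intD//; last 3 first.
- exact: measurable_funM.
- by move=> y _; rewrite !exprn_ge0// oscmax_ge0.
- by move=> y _; rewrite mulr_ge0.
rewrite ball_intZ//; apply: leeD; first exact: oscmax_moment.
apply: le_trans (lee_wpmul2l _ bN) _; first by rewrite lee_fin.
rewrite -EFinM lee_fin mulrCA ler_piMr ?(ltW e0)// ler_pdivrMr ?ltr_wpDl// mul1r.
by rewrite lerDl.
Qed.

End JohnNirenberg.

(** * Measurability of the operator, Hoelder's inequality and the Morrey norm *)

Section Measurability.
Context {R : realType} {p n : nat}.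
Hypothesis p_pr : prime p.
Variable mu : {measure set (QpnM p n) -> \bar R}.
Hypothesis muB : forall (x : QpnM p n) g, mu (ballM x g) = (ballvol R p n g)%:E.
Implicit Types (x y z : QpnM p n) (g h : int) (u v : QpnM p n -> R).
Local Notation V := (ballvol R p n).
Local Notation mball := (measurable_ballM _ _).
Local Notation V_gt0 g := (@ballvol_gt0 R p n p_pr g).

Lemma measurable_ereal_sup_range d (T : measurableType d) (f : nat -> T -> \bar R) :
  (forall k, measurable_fun setT (f k)) ->
  measurable_fun setT (fun t => ereal_sup (range (f ^~ t))).
Proof.
move=> mf; have := @measurable_fun_esups _ _ R setT f mf 0%N.
rewrite (_ : (fun t => esups (f ^~ t) 0) = fun t => ereal_sup (range (f ^~ t)))//.
apply/funext => t; rewrite /esups/=; congr ereal_sup.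
by apply/seteqP; split=> [_ [k _ <-]|_ [k _ <-]]; exists k.
Qed.

Lemma sigma_finite_mu : sigma_finite setT mu.
Proof.
exists (partM 0); first by rewrite bigcup_partM.
move=> i; split; first exact: measurable_partM.
case: (@partM_set0_or_ball p n 0 i) => ->; first by rewrite measure0.
by rewrite muB ltry.
Qed.

(* A copy of [mu] carrying the sigma-finite structure that Tonelli requires. *)
Definition haar : set (QpnM p n) -> \bar R := mu.
HB.instance Definition _ := Measure.copy haar mu.
HB.instance Definition _ := Measure_isSigmaFinite.Build _ _ _ haar sigma_finite_mu.

(** The contribution of a single radius, with [a] standing for [alpha / n]. *)
Definition frac_term (a : R) (b f : QpnM p n -> R) g x : \bar R :=
  ((V g `^ (a - 1))%:E * \int[mu]_(y in ballM x g) (`|b x - b y| * `|f y|)%:E)%E.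

Lemma frac_term_ge0 a b f g x : (0 <= frac_term a b f g x)%E.
Proof.
apply: mule_ge0; first by rewrite lee_fin powR_ge0.
by apply: integral_ge0 => y _; rewrite lee_fin mulr_ge0.
Qed.

(** While [x] stays in one ball of level [g], the domain of integration is that fixed ball; the
    integral is then a section integral of a measurable function on the product, and Tonelli's
    theorem applies piece by piece. *)
Lemma measurable_frac_term a b f g : measurable_fun setT b -> measurable_fun setT f ->
  measurable_fun setT (frac_term a b f g).
Proof.
move=> mb mf; apply: measurable_funeM.
rewrite -(bigcup_partM g); apply/measurable_fun_bigcup => i; first exact: measurable_partM.
case: (@partM_set0_or_ball p n g i) => ->; first exact: measurable_fun_set0.
set z := Qpn_of_nat i.
pose k (t : QpnM p n * QpnM p n) := ((`|b t.1 - b t.2| * `|f t.2|) * \1_(ballM z g) t.2)%:E.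
have k0 t : (0 <= k t)%E by rewrite lee_fin mulr_ge0 ?mulr_ge0.
have mk : measurable_fun setT k.
  apply/measurable_EFinP; apply: measurable_funM; last first.
    apply: (@measurableT_comp _ _ _ _ _ _ (\1_(ballM z g) : QpnM p n -> R) _ snd) => //.
    by apply: measurable_indic; exact: mball.
  apply: measurable_funM.
    apply: measurableT_comp => //; apply: measurable_funB.
      exact: (measurableT_comp mb).
    exact: (measurableT_comp mb).
  apply: measurableT_comp => //; exact: (measurableT_comp mf).
have := @measurable_fun_fubini_tonelli_F _ _ (QpnM p n) (QpnM p n) R haar k mk k0.
move/(@measurable_funTS _ _ _ _ (ballM z g))/eq_measurable_fun; apply => x.
rewrite inE => /ballM_eq ->; rewrite /fubini_F [RHS]integral_mkcond.
apply: eq_integral => y _; rewrite /k /patch indicE.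
by case: ifP; rewrite ?mulr1 ?mulr0.
Qed.

(** Enumerating the integers makes this a supremum over a sequence, hence measurable. Codes of no
    integer fall back to level 0 and repeat a term already present. *)
Lemma frac_max_commE (alpha : R) b f x : frac_max_comm mu alpha b f x =
  ereal_sup (range (fun k : nat => frac_term (alpha / n%:R) b f (odflt 0 (unpickle k)) x)).
Proof.
rewrite /frac_max_comm; congr ereal_sup; apply/seteqP; split=> [z [g ->]|_ [k _ <-]].
  by exists (pickle g) => //; rewrite pickleK.
by exists (odflt 0 (unpickle k)).
Qed.

Lemma measurable_frac_max_comm (alpha : R) b f : measurable_fun setT b -> measurable_fun setT f ->
  measurable_fun setT (frac_max_comm mu alpha b f).
Proof.
move=> mb mf; rewrite (funext (frac_max_commE alpha b f)).
by apply: measurable_ereal_sup_range => k; exact: measurable_frac_term.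
Qed.

Lemma ball_hoelder x g (P Q : R) u v : 0 < P -> 0 < Q -> P^-1 + Q^-1 = 1 ->
  measurable_fun setT u -> measurable_fun setT v ->
  (forall y, 0 <= u y) -> (forall y, 0 <= v y) ->
  (\int[mu]_(y in ballM x g) (u y * v y)%:E <=
   (\int[mu]_(y in ballM x g) (u y `^ P)%:E) `^ P^-1 *
   (\int[mu]_(y in ballM x g) (v y `^ Q)%:E) `^ Q^-1)%E.
Proof.
move=> P0 Q0 PQ mu_ mv u0 v0.
pose B := ballM x g; pose w (u : QpnM p n -> R) y := u y * \1_B y.
have mw t : measurable_fun setT t -> measurable_fun setT (w t).
  by move=> mt; apply: measurable_funM => //; apply: measurable_indic; exact: mball.
have := @hoelder _ _ R mu (w u) (w v) P Q (mw _ mu_) (mw _ mv) P0 Q0 PQ.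
have E t (T : R) : 0 < T -> (forall y, 0 <= t y) ->
    (\int[mu]_y (`|(EFin \o w t) y| `^ T) = \int[mu]_(y in B) (t y `^ T)%:E)%E.
  move=> T0 t0; rewrite [RHS]integral_mkcond; apply: eq_integral => y _.
  rewrite /w /= /patch indicE; case: ifP => _; first by rewrite mulr1 ger0_norm.
  by rewrite mulr0 normr0 powR0// gt_eqF.
rewrite Lnorm1 unlock !E//; apply: le_trans.
rewrite [leLHS]integral_mkcond le_eqVlt; apply/orP; left; apply/eqP.
apply: eq_integral => y _; rewrite /w /= /patch indicE.
case: ifP => _; first by rewrite !mulr1 ger0_norm// mulr_ge0.
by rewrite !mulr0 normr0.
Qed.

Lemma morrey_normP (q l C : R) (F : QpnM p n -> \bar R) : 0 < q -> 0 <= C ->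
  (morrey_norm mu q l F <= C%:E)%E <->
  (forall x g, \int[mu]_(y in ballM x g) (`|F y| `^ q) <= (C `^ q * V g `^ (l / n%:R))%:E)%E.
Proof.
move=> q0 C0.
have key x g : (((V g `^ (- l / n%:R))%:E * \int[mu]_(y in ballM x g) (`|F y| `^ q)) `^ q^-1 <= C%:E)%E
    <-> (\int[mu]_(y in ballM x g) (`|F y| `^ q) <= (C `^ q * V g `^ (l / n%:R))%:E)%E.
  set I := (\int[mu]_(y in ballM x g) (`|F y| `^ q))%E.
  have I0 : (0 <= I)%E by apply: integral_ge0 => y _; exact: poweR_ge0.
  have v0 : 0 < V g `^ (l / n%:R) by rewrite powR_gt0// (V_gt0 g).
  rewrite mulNr powRN; set v := V g `^ _ in v0 *.
  have vI0 : (0 <= v^-1%:E * I)%E by rewrite mule_ge0// lee_fin invr_ge0 ltW.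
  have -> : ((v^-1%:E * I) `^ q^-1 <= C%:E)%E = (v^-1%:E * I <= (C `^ q)%:E)%E.
    apply/idP/idP => H.
      rewrite -[leLHS]poweRe1// -(mulVf (lt0r_neq0 q0)) poweRrM -poweR_EFin.
      apply: gt0_ler_poweR => //; first exact: ltW.
        by rewrite in_itv/= poweR_ge0 leey.
      by rewrite in_itv/= lee_fin C0 leey.
    rewrite -[leRHS]poweRe1 ?lee_fin// -(mulfV (lt0r_neq0 q0)) poweRrM poweR_EFin.
    apply: gt0_ler_poweR => //; first by rewrite invr_ge0 ltW.
      by rewrite in_itv/= vI0 leey.
    by rewrite in_itv/= lee_fin powR_ge0 leey.
  by rewrite lee_pdivrMl// EFinM muleC.
split=> [H x g|H].
  by apply/key; apply: le_trans H; apply: ereal_sup_ubound; exists x, g.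
by apply: ge_ereal_sup => _ [x [g ->]]; apply/key.
Qed.

End Measurability.

(** * Index arithmetic and elementary power inequalities *)

Lemma subz_split (g : int) (i j : nat) : (i <= j)%N -> g - j%:Z = (g - i%:Z) - (j - i)%N%:Z.
Proof. lia. Qed.

Lemma lez_dist (g h : int) : g <= h -> g = h - `|h - g|%N%:Z.
Proof. lia. Qed.

Lemma gez_dist (g h : int) : h <= g -> g = h + `|g - h|%N%:Z.
Proof. lia. Qed.

Section Powers.
Context {R : realType}.
Implicit Types (x y M : R).

(** Lowers an exponent by cutting at a height: the first term serves for [x <= M], the second
    beyond. When [M] bounds the mean size of order [r] on a ball, both terms have mean at most
    [M ^ s]. *)
Lemma powR_split M x (s r : R) : 0 < M -> 0 <= x -> 0 < s -> s <= r ->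
  x `^ s <= M `^ s + M `^ (s - r) * x `^ r.
Proof.
move=> M0 x0 s0 sr; have [xM|Mx] := leP x M.
  apply: (@le_trans _ _ (M `^ s)); last by rewrite lerDl mulr_ge0 ?powR_ge0.
  by rewrite ge0_ler_powR ?nnegrE ?(ltW s0)// ltW.
apply: (@le_trans _ _ (M `^ (s - r) * x `^ r)); last by rewrite lerDr powR_ge0.
have x0' : 0 < x by exact: lt_trans Mx.
have -> : x `^ r = x `^ (r - s) * x `^ s.
  by rewrite -powRD ?subrK// (gt_eqF x0') implybT.
rewrite mulrA ler_peMl ?powR_ge0// -(opprB r s) powRN ler_pdivlMl ?powR_gt0//.
by rewrite mulr1 ge0_ler_powR ?subr_ge0 ?nnegrE// ltW.
Qed.

Lemma powR_le1D x (q : R) (t : nat) : 0 <= x -> 0 <= q -> q <= t%:R -> x `^ q <= 1 + x ^+ t.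
Proof.
move=> x0 q0 qt; have [x1|x1] := leP x 1.
  have : x `^ q <= 1 `^ q by rewrite ge0_ler_powR ?nnegrE.
  by rewrite powR1 => /le_trans; apply; rewrite lerDl exprn_ge0.
have : x `^ q <= x `^ t%:R by rewrite ler_powR// ltW.
by rewrite powR_mulrn// => /le_trans; apply; rewrite lerDr.
Qed.

Lemma exprD_le x y (t : nat) : 0 <= x -> 0 <= y -> (x + y) ^+ t <= 2 ^+ t * (x ^+ t + y ^+ t).
Proof.
move=> x0 y0; wlog xy : x y x0 y0 / x <= y => [H|].
  have [|/ltW] := leP x y; first exact: H.
  by rewrite [x + y]addrC [x ^+ t + _]addrC; exact: H.
apply: (@le_trans _ _ ((2 * y) ^+ t)).
  by rewrite lerXn2r ?nnegrE ?mulr_ge0 ?addr_ge0//; lra.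
by rewrite exprMn ler_wpM2l ?exprn_ge0// lerDr exprn_ge0.
Qed.

Lemma exprD_ge x y (t : nat) : 0 <= x -> 0 <= y -> x ^+ t.+1 + y ^+ t.+1 <= (x + y) ^+ t.+1.
Proof.
move=> x0 y0; elim: t => [|t IH]; first by rewrite !expr1.
rewrite [leRHS]exprS; apply: le_trans (ler_wpM2l (addr_ge0 x0 y0) IH).
have := mulr_ge0 x0 (exprn_ge0 t.+1 y0); have := mulr_ge0 y0 (exprn_ge0 t.+1 x0).
rewrite mulrDl !mulrDr -!exprS; lra.
Qed.

Lemma bernoulli x (k : nat) : 0 <= x -> 1 + k%:R * x <= (1 + x) ^+ k.
Proof.
move=> x0; elim: k => [|k IH]; first by rewrite mul0r addr0 expr0.
rewrite exprS; apply: le_trans (ler_wpM2l (addr_ge0 ler01 x0) IH).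
have : 0 <= k%:R * x * x by rewrite !mulr_ge0.
by rewrite -natr1; lra.
Qed.

End Powers.

(** * Pointwise bounds for the operator with a symbol of bounded mean oscillation *)

Section Estimates.
Context {R : realType} {p n : nat}.
Hypothesis p_pr : prime p.
Variable mu : {measure set (QpnM p n) -> \bar R}.
Hypothesis muB : forall (x : QpnM p n) g, mu (ballM x g) = (ballvol R p n g)%:E.
Implicit Types (x y z : QpnM p n) (g h : int) (u v : QpnM p n -> R).
Local Notation V := (ballvol R p n).
Local Notation mball := (measurable_ballM _ _).
Local Notation avg := (ball_avg mu).
Local Notation V_gt0 g := (@ballvol_gt0 R p n p_pr g).

Variable b : QpnM p n -> R.
Hypothesis lb : loc_integrable mu b.
Variable K : R.
Hypothesis K0 : 0 <= K.
Hypothesis bK : forall x g,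
  (\int[mu]_(y in ballM x g) (`|b y - avg b x g|)%:E <= (K * V g)%:E)%E.
Variables (m : nat) (s : R).
Hypothesis m0 : (0 < m)%N.
Hypothesis s1 : 1 < s.
Hypothesis ms : m%:R^-1 + s^-1 = 1 :> R.
Local Notation J := (@jn_const R p n K).
Local Notation D := (@bmo_jump R p n K).

Let mb : measurable_fun setT b. Proof. by case: lb. Qed.
Let J0 t : 0 <= J t. Proof. exact: jn_const_ge0. Qed.
Let s0 : 0 < s. Proof. exact: lt_trans ltr01 s1. Qed.

(* The summand [1] makes [J m <= hb ^ m]. *)
Definition hb : R := 1 + J m.

(** Bounds the mean of order [m] of [|b x - b y|] over [y] in the ball; the factor 2 comes from (u +
    v)^m <= 2^m (u^m + v^m). *)
Definition oscH g x : R := 2 * (`|b x - avg b x g| + hb).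

Lemma hb_ge1 : 1 <= hb. Proof. by rewrite lerDl. Qed.

Lemma oscH_gt0 g x : 0 < oscH g x.
Proof. by rewrite mulr_gt0// ltr_wpDl// (lt_le_trans ltr01 hb_ge1). Qed.

Lemma dist_moment x g :
  (\int[mu]_(y in ballM x g) (`|b x - b y| ^+ m)%:E <= (oscH g x ^+ m * V g)%:E)%E.
Proof.
set c := avg b x g; set d := `|b x - c|.
have mbc : measurable_fun setT (fun y => `|b y - c| ^+ m).
  by apply: measurable_funX; exact: (loc_integrable_dist muB lb c).1.
apply: (@le_trans _ _ (\int[mu]_(y in ballM x g) (2 ^+ m * (d ^+ m + `|b y - c| ^+ m))%:E)%E).
  apply: ball_int_le => //.
  - by apply: measurable_funX; apply: measurableT_comp => //; exact: measurable_funB.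
  - by apply: measurable_funM => //; exact: measurable_funD.
  - move=> y _; apply: le_trans (exprD_le _ (normr_ge0 _) (normr_ge0 _)).
    rewrite lerXn2r ?nnegrE ?addr_ge0 ?normr_ge0// /d [`|b y - c|]distrC.
    exact: ler_distD.
have d0 : 0 <= d ^+ m by apply/exprn_ge0/normr_ge0.
rewrite ball_intZ//; last 2 first.
- exact: measurable_funD.
- by move=> y _; rewrite addr_ge0// exprn_ge0.
rewrite ball_intD//.
rewrite (ball_int_cst muB).
apply: le_trans (lee_wpmul2l _ (leeD (lexx _) (john_nirenberg p_pr muB lb K0 bK x g m))) _.
  by rewrite lee_fin exprn_ge0.
rewrite -EFinD -EFinM lee_fin -mulrDl mulrA ler_wpM2r ?(ltW (V_gt0 _))//.
rewrite /oscH exprMn ler_wpM2l ?exprn_ge0// -/c -/d.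
have h0 : 0 <= hb by apply: le_trans hb_ge1.
move: d0; rewrite -(prednK m0) => d0.
apply: le_trans (exprD_ge _ (normr_ge0 _) h0).
rewrite lerD2l; apply: (@le_trans _ _ hb); first by rewrite /hb (prednK m0) lerDr.
by rewrite -[leLHS]expr1 ler_weXn2l// hb_ge1.
Qed.

Variables (a k r A : R) (f : QpnM p n -> R).
Hypothesis sr : s < r.
Hypothesis A0 : 0 < A.
Hypothesis mf : measurable_fun setT f.
Hypothesis fA : forall x g,
  (\int[mu]_(y in ballM x g) (`|f y| `^ r)%:E <= (A `^ r * V g `^ (1 - r * k))%:E)%E.

Local Notation fs := (fun y => `|f y| `^ s).
(** Dividing [fA] by the volume and taking the [r]-th root shows that this bounds the mean of order
    [r] of [f] on balls of level [g]. *)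
Let M g := A * V g `^ (- k).

Let M0 g : 0 < M g. Proof. by rewrite mulr_gt0// powR_gt0// (V_gt0 g). Qed.
Let mfs : measurable_fun setT fs.
Proof. by apply: measurable_fun_powR; exact: measurableT_comp. Qed.
Let mfr : measurable_fun setT (fun y => `|f y| `^ r).
Proof. by apply: measurable_fun_powR; exact: measurableT_comp. Qed.

Lemma int_powR_s x g :
  (\int[mu]_(y in ballM x g) (fs y)%:E <= ((2 * M g) `^ s * V g)%:E)%E.
Proof.
apply: (@le_trans _ _ (\int[mu]_(y in ballM x g)
    (M g `^ s + M g `^ (s - r) * `|f y| `^ r)%:E)%E).
  apply: ball_int_le => //.
  - by apply: measurable_funD => //; exact: measurable_funM.
  - by move=> y _; rewrite powR_split// ltW.
rewrite ball_intD//; first last.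
- by move=> y _; rewrite mulr_ge0 ?powR_ge0.
- by move=> y _; exact: powR_ge0.
- exact: measurable_funM.
rewrite ball_intZ ?powR_ge0//.
rewrite (ball_int_cst muB).
apply: le_trans (leeD (lexx _) (lee_wpmul2l _ (fA x g))) _; first by rewrite lee_fin powR_ge0.
have -> : A `^ r * V g `^ (1 - r * k) = M g `^ r * V g.
  rewrite /M powRM ?powR_ge0 ?(ltW A0)// -mulrA; congr (_ * _).
  have -> : 1 - r * k = - k * r + 1 by ring.
  rewrite powRD ?(gt_eqF (V_gt0 g)) ?implybT// powRrM powRr1//.
  exact: ltW (V_gt0 g).
rewrite -EFinM -EFinD lee_fin mulrA -powRD ?(gt_eqF (M0 g)) ?implybT// subrK -mulrDl.
rewrite ler_wpM2r ?(ltW (V_gt0 _))// powRM ?(ltW (M0 _))//.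
have : 2 <= 2 `^ s :> R by rewrite -[leLHS](@powRr1 _ 2)// ler_powR ?ltW//; lra.
have := powR_ge0 (M g) s; move: (powR _ _) (powR _ _) => X Y; nra.
Qed.

Lemma loc_integrable_fs : loc_integrable mu fs.
Proof.
apply: (loc_integrable_ge0 (mu := mu)) => // x g.
by apply: le_lt_trans (int_powR_s x g) (ltry _).
Qed.

Lemma avg_fs_le x g : avg fs x g <= (2 * M g) `^ s.
Proof.
rewrite -(ler_pM2r (V_gt0 g)) -lee_fin -ball_avgE//; first exact: int_powR_s.
exact: loc_integrable_fs.
Qed.

Lemma avg_fs_ge0 x g : 0 <= avg fs x g.
Proof. by apply: ball_avg_ge0 => // y; exact: powR_ge0. Qed.

(** Hoelder's inequality with the conjugate exponents [m] and [s]. The two roots of the volume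
    multiply to one full power, which turns [a - 1] into [a]. *)
Lemma frac_term_le x g :
  (frac_term mu a b f g x <= (V g `^ a * oscH g x * avg fs x g `^ s^-1)%:E)%E.
Proof.
have mR : 0 < m%:R :> R by rewrite ltr0n.
have V0 := V_gt0 g.
have H0 := oscH_gt0 g x.
have mbx : measurable_fun setT (fun y => `|b x - b y|).
  by apply: measurableT_comp => //; exact: measurable_funB.
rewrite /frac_term; have -> : V g `^ a * oscH g x * avg fs x g `^ s^-1 =
    V g `^ (a - 1) * ((oscH g x ^+ m * V g) `^ m%:R^-1 * (avg fs x g * V g) `^ s^-1).
  move: (avg fs x g) (avg_fs_ge0 x g) => e e0.
  rewrite !powRM ?exprn_ge0 ?(ltW V0) ?(ltW H0)//.
  rewrite -[oscH g x ^+ m]powR_mulrn ?(ltW H0)// -powRrM mulfV ?(gt_eqF mR)// powRr1 ?(ltW H0)//.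
  have -> : V g `^ a = V g `^ (a - 1) * (V g `^ m%:R^-1 * V g `^ s^-1).
    by rewrite -!powRD ?(gt_eqF V0) ?implybT// ms subrK.
  by ring.
rewrite EFinM lee_wpmul2l ?lee_fin ?powR_ge0//.
have mfn : measurable_fun setT (fun y => `|f y|) by exact: measurableT_comp.
apply: le_trans (ball_hoelder mu x g mR s0 ms mbx mfn _ _) _ => //.
rewrite EFinM; apply: lee_pmul; rewrite ?poweR_ge0// -poweR_EFin.
  apply: gt0_ler_poweR; first by rewrite invr_ge0.
  - by rewrite in_itv/= leey andbT ball_int_ge0// => y _; exact: powR_ge0.
  - by rewrite in_itv/= leey andbT lee_fin mulr_ge0 ?exprn_ge0// ltW.
  - under eq_integral do rewrite powR_mulrn//.
    exact: dist_moment.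
rewrite -ball_avgE//; exact: loc_integrable_fs.
Qed.

Lemma frac_term_le2 x g :
  (frac_term mu a b f g x <= (V g `^ a * oscH g x * (2 * M g))%:E)%E.
Proof.
apply: le_trans (frac_term_le x g) _; rewrite lee_fin ler_wpM2l//.
  by rewrite mulr_ge0 ?powR_ge0// ltW// oscH_gt0.
have M2 : 0 <= 2 * M g by rewrite mulr_ge0// ltW// M0.
have -> : 2 * M g = ((2 * M g) `^ s) `^ s^-1.
  by rewrite -powRrM (mulfV (lt0r_neq0 s0)) powRr1.
apply: ge0_ler_powR.
- by rewrite invr_ge0 ltW.
- by rewrite nnegrE; exact: avg_fs_ge0.
- by rewrite nnegrE powR_ge0.
- exact: avg_fs_le.
Qed.

Lemma frac_term_fin x g : frac_term mu a b f g x \is a fin_num.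
Proof.
rewrite ge0_fin_numE ?frac_term_ge0//.
exact: le_lt_trans (frac_term_le x g) (ltry _).
Qed.

(** * Contribution of the balls inside a given ball *)

Variables (q : R) (t : nat).
Hypothesis a0 : 0 < a.
Hypothesis ak : a < k.
Hypothesis qE : q * (k - a) = r * k.
Hypothesis qt : q <= t%:R.

Let rpos : 0 < r. Proof. exact: lt_trans sr. Qed.
Let ka0 : 0 < k - a. Proof. by rewrite subr_gt0. Qed.
Let q_gt0 : 0 < q.
Proof.
by rewrite -(pmulr_lgt0 _ ka0) qE mulr_gt0// (lt_trans a0).
Qed.
Let rq : r <= q.
Proof.
rewrite -(ler_pM2r ka0) qE ler_wpM2l ?(ltW rpos)//.
by rewrite gerBl ltW.
Qed.

(** A common majorant of [oscH] at the first [N] levels from [h] downward; its [q]-th moment over a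
    ball of level [h] is bounded uniformly in [N]. *)
Definition oscHmax h N x : R :=
  2 * (`|b x - avg b x h| + oscmax mu b h (avg b x h) N x ^+ 2 + hb).

Lemma oscHmax_ge0 h N x : 0 <= oscHmax h N x.
Proof.
have h0 : 0 <= hb by apply: le_trans hb_ge1.
apply: mulr_ge0 => //; apply: addr_ge0 => //; apply: addr_ge0 => //.
exact/exprn_ge0/oscmax_ge0.
Qed.

Lemma oscH_le_max h (N j : nat) x : (j < N)%N -> oscH (h - j%:Z) x <= oscHmax h N x.
Proof.
move=> jN; rewrite ler_wpM2l// lerD2r.
have := ler_distD (avg b x h) (b x) (avg b x (h - j%:Z)).
have := avg_dist_oscmax mu b h (avg b x h) x jN.
rewrite (distrC (avg b x h)); lra.
Qed.

Lemma measurable_oscHmax h N : measurable_fun setT (oscHmax h N).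
Proof.
have mo : measurable_fun setT (fun x => oscmax mu b h (avg b x h) N x ^+ 2).
  apply: (@measurable_lconst _ _ _ _ (h - N%:Z)) => x y xy.
  have xy' : ballM x h y by apply: subset_ballM xy; rewrite gerBl.
  rewrite (lconst_ball_avg mu b xy'); congr (_ ^+ 2); move: x y xy {xy'}.
  move=> x y; apply: lconst_oscmax => i iN.
  by rewrite lerD2l lerN2 lez_nat ltnW.
apply: measurable_funM => //; apply: measurable_funD => //; apply: measurable_funD => //.
apply: measurableT_comp => //; apply: measurable_funB => //.
exact: (measurable_avg_comp mu b id).
Qed.

(** The 1 is from [x ^ q <= 1 + x ^ t], and 6 is the factor 2 of [oscHmax] times 3 for its three
    summands, two of which have moments bounded by [J t]. *)
Definition momentH : R := 1 + 6 ^+ t * (2 * J t + hb ^+ t).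

Lemma momentH_gt0 : 0 < momentH.
Proof.
have h0 : 0 <= hb by apply: le_trans hb_ge1.
rewrite ltr_pwDl//; apply: mulr_ge0; first exact: exprn_ge0.
by apply: addr_ge0; [apply: mulr_ge0|exact: exprn_ge0].
Qed.

Lemma oscHmax_moment x h N :
  (\int[mu]_(y in ballM x h) (oscHmax h N y `^ q)%:E <= (momentH * V h)%:E)%E.
Proof.
set c := avg b x h.
have h0 : 0 <= hb by apply: le_trans hb_ge1.
pose o y := oscmax mu b h c N y ^+ 2.
have o0 y : 0 <= o y by rewrite exprn_ge0// oscmax_ge0.
have mo : measurable_fun setT (fun y => o y ^+ t).
  exact: (@measurable_oscmax_comp _ _ _ mu b (fun s => (s ^+ 2) ^+ t)).
have mbc : measurable_fun setT (fun y => `|b y - c| ^+ t).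
  by apply: measurable_funX; exact: (loc_integrable_dist muB lb c).1.
have d0 y : 0 <= `|b y - c| ^+ t by rewrite exprn_ge0.
have ot0 y : 0 <= o y ^+ t by rewrite exprn_ge0.
apply: (@le_trans _ _ (\int[mu]_(y in ballM x h)
   (1 + 6 ^+ t * (`|b y - c| ^+ t + o y ^+ t + hb ^+ t))%:E)%E).
  apply: ball_int_le => //.
  - by apply: measurable_fun_powR; exact: measurable_oscHmax.
  - apply: measurable_funD => //; apply: measurable_funM => //.
    by apply: measurable_funD => //; exact: measurable_funD.
  - by move=> y _; exact: powR_ge0.
  - move=> y xy; apply: le_trans (powR_le1D (oscHmax_ge0 _ _ _) (ltW q_gt0) qt) _.
    rewrite lerD2l /oscHmax (lconst_ball_avg mu b xy) -/c -/(o y).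
    rewrite exprMn (_ : 6 = 2 * 3 :> R); last by ring.
    rewrite exprMn -mulrA ler_wpM2l ?exprn_ge0//.
    move: (o0 y) (normr_ge0 (b y - c)) h0; move: (`|b y - c|) (o y) hb => X Y Z Y0 X0 Z0.
    pose W := Num.max X (Num.max Y Z).
    have W0 : 0 <= W by rewrite le_max X0.
    have XW : X <= W by rewrite le_max lexx.
    have YW : Y <= W by rewrite !le_max lexx orbT.
    have ZW : Z <= W by rewrite !le_max lexx !orbT.
    apply: (@le_trans _ _ ((3 * W) ^+ t)).
      by rewrite lerXn2r ?nnegrE ?addr_ge0 ?mulr_ge0//; lra.
    rewrite exprMn ler_wpM2l ?exprn_ge0//.
    have := exprn_ge0 t X0; have := exprn_ge0 t Y0; have := exprn_ge0 t Z0.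
    rewrite /W !maxEle; case: ifP => _; last by lra.
    by case: ifP => _; lra.
have m2 : measurable_fun setT (fun y => `|b y - c| ^+ t + o y ^+ t).
  exact: measurable_funD.
have m3 : measurable_fun setT (fun y => `|b y - c| ^+ t + o y ^+ t + hb ^+ t).
  exact: measurable_funD.
have hbt0 : 0 <= hb ^+ t by rewrite exprn_ge0.
have p2 y : 0 <= `|b y - c| ^+ t + o y ^+ t by rewrite addr_ge0.
have p3 y : 0 <= `|b y - c| ^+ t + o y ^+ t + hb ^+ t by rewrite addr_ge0.
have c6 : 0 <= 6 ^+ t :> R by rewrite exprn_ge0.
rewrite ball_intD//; last 2 first.
- exact: measurable_funM.
- by move=> y _; rewrite mulr_ge0.
rewrite ball_intZ// ball_intD// ball_intD// !(ball_int_cst muB).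
have e1 := john_nirenberg p_pr muB lb K0 bK x h t.
have e2 := oscmax_moment p_pr muB lb K0 bK x h N t.
apply: le_trans (leeD (lexx _) (lee_wpmul2l _ (leeD (leeD e1 e2) (lexx _)))) _.
  by rewrite lee_fin.
have -> : momentH * V h = 1 * V h + 6 ^+ t * (J t * V h + J t * V h + hb ^+ t * V h).
  by rewrite /momentH; ring.
exact: lexx.
Qed.

Local Notation P := (r / s).
Let P1 : 1 < P. Proof. by rewrite ltr_pdivlMr ?mul1r. Qed.
Local Notation S g0 := (avgmax mu 0 fs g0).

(** Increment number [i] is paired with a majorant of the oscillations from level [g0 - i] downward.
    The increment is constant on balls of that level, so the majorant can be integrated over them
    first. *)
Definition near_sum g0 N x : R :=
  \sum_(i < N) (S g0 i.+1 x `^ P - S g0 i x `^ P) * oscHmax (g0 - i%:Z) N x `^ q.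

Let wS g0 i x : 0 <= S g0 i.+1 x `^ P - S g0 i x `^ P.
Proof.
have S0 j : 0 <= S g0 j x by exact: (@runmax_le _ 0 _ 0 j).
rewrite subr_ge0; apply: ge0_ler_powR; rewrite ?nnegrE; [|exact: S0|exact: S0|exact: runmax_le].
exact: ltW (lt_trans ltr01 P1).
Qed.

Let mwS g0 i : measurable_fun setT (fun x => S g0 i.+1 x `^ P - S g0 i x `^ P).
Proof.
by apply: measurable_funB; exact: (@measurable_avgmax_comp _ _ _ mu (fun a => a `^ P)).
Qed.

(** The average at level [g0 - j] is at most the running maximum at index [j.+1], whose power is the
    sum of its first [j.+1] increments, and for each of these the majorant covers level [g0 - j]. *)
Lemma near_sum_ge g0 N (j : nat) x : (j < N)%N ->
  avg fs x (g0 - j%:Z) `^ P * oscH (g0 - j%:Z) x `^ q <= near_sum g0 N x.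
Proof.
move=> jN; pose c i := (S g0 i.+1 x `^ P - S g0 i x `^ P).
apply: (@le_trans _ _ (\sum_(i < j.+1) c i * oscH (g0 - j%:Z) x `^ q)).
  rewrite -mulr_suml ler_wpM2r ?powR_ge0//.
  rewrite /c -(big_mkord xpredT (fun i => S g0 i.+1 x `^ P - S g0 i x `^ P)) telescope_sumr//.
  rewrite {2}/avgmax/= powR0 ?subr0; last exact: lt0r_neq0 (lt_trans ltr01 P1).
  apply: ge0_ler_powR; rewrite ?nnegrE.
  - exact: ltW (lt_trans ltr01 P1).
  - exact: avg_fs_ge0.
  - exact: (@runmax_le _ 0 _ 0 j.+1).
  - exact: (@runmax_ge _ 0 (fun j => avg fs x (g0 - j%:Z)) j).
apply: (@le_trans _ _ (\sum_(i < j.+1) c i * oscHmax (g0 - i%:Z) N x `^ q)).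
  apply: ler_sum => i _; rewrite ler_wpM2l//; first exact: wS.
  apply: ge0_ler_powR; rewrite ?nnegrE; [exact: ltW|exact/ltW/oscH_gt0|exact: oscHmax_ge0|].
  rewrite (subz_split g0 (ltn_ord i : (i <= j)%N)).
  by apply: oscH_le_max; exact: leq_ltn_trans (leq_subr _ _) jN.
rewrite /near_sum -(big_mkord xpredT (fun i => c i * oscHmax (g0 - i%:Z) N x `^ q)).
rewrite -(big_mkord xpredT (fun i => (S g0 i.+1 x `^ P - S g0 i x `^ P) * oscHmax (g0 - i%:Z) N x `^ q)).
rewrite [leRHS](@big_cat_nat _ _ _ j.+1)//= lerDl sumr_ge0// => i _.
by rewrite mulr_ge0 ?powR_ge0//; exact: wS.
Qed.

Lemma near_sum_ge0 g0 N x : 0 <= near_sum g0 N x.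
Proof. by apply: sumr_ge0 => i _; rewrite mulr_ge0 ?powR_ge0//; exact: wS. Qed.

Lemma measurable_near_sum g0 N : measurable_fun setT (near_sum g0 N).
Proof.
apply: measurable_sum => i; apply: measurable_funM; first exact: mwS.
by apply: measurable_fun_powR; exact: measurable_oscHmax.
Qed.

Variable CD : R.
Hypothesis CD0 : 0 < CD.
Hypothesis doobP : forall u x0 g0 N, loc_integrable mu u -> (forall x, 0 <= u x) ->
  (\int[mu]_(x in ballM x0 g0) (avgmax mu 0 u g0 N x `^ P)%:E <=
   CD%:E * \int[mu]_(x in ballM x0 g0) (u x `^ P)%:E)%E.

(** On the balls where an increment is constant its majorant has mean at most [momentH]. The
    increments then telescope, and Doob's inequality for |f|^s with exponent [P = r / s] brings back
    the integral of |f|^r. *)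
Lemma near_sum_int x0 g0 N :
  (\int[mu]_(y in ballM x0 g0) (near_sum g0 N y)%:E <=
   (momentH * CD * (A `^ r * V g0 `^ (1 - r * k)))%:E)%E.
Proof.
have mH0 := ltW momentH_gt0.
rewrite (@ball_int_sum _ _ _ mu x0 g0 N (fun i y =>
  (S g0 i.+1 y `^ P - S g0 i y `^ P) * oscHmax (g0 - i%:Z) N y `^ q)); last 2 first.
- move=> i; apply: measurable_funM; first exact: mwS.
  by apply: measurable_fun_powR; exact: measurable_oscHmax.
- by move=> i y; rewrite mulr_ge0 ?powR_ge0//; exact: wS.
apply: (@le_trans _ _ (\sum_(i < N) \int[mu]_(y in ballM x0 g0)
    (momentH * (S g0 i.+1 y `^ P - S g0 i y `^ P))%:E)%E).
  apply: lee_sum => i _.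
  under eq_integral do rewrite EFinM.
  under [leRHS]eq_integral do rewrite mulrC EFinM.
  apply: (@integral_lconst_le R p n mu x0 g0 (g0 - i%:Z) _
    (fun y => (oscHmax (g0 - i%:Z) N y `^ q)%:E) (cst momentH%:E)).
  - by rewrite gerBl.
  - have H l : (l <= i.+1)%N -> lconst (g0 - i%:Z) (S g0 l).
      by move=> li; apply: lconst_avgmax => l' ll; rewrite lerD2l lerN2 lez_nat -ltnS (leq_trans ll).
    by move=> x y xy; rewrite (H i.+1 (leqnn _) x y xy) (H i (leqnSn _) x y xy).
  - exact: wS.
  - by apply/measurable_EFinP; apply: measurable_fun_powR; exact: measurable_oscHmax.
  - exact: measurable_cst.
  - by move=> y; rewrite lee_fin powR_ge0.
  - by move=> y; rewrite lee_fin.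
  - by move=> x _; rewrite (ball_int_cst muB); exact: oscHmax_moment.
rewrite -(@ball_int_sum _ _ _ mu x0 g0 N (fun i y => momentH * (S g0 i.+1 y `^ P - S g0 i y `^ P))); last 2 first.
- by move=> i; apply: measurable_funM => //; exact: mwS.
- by move=> i y; rewrite mulr_ge0//; exact: wS.
rewrite (eq_integral (fun y => (momentH * S g0 N y `^ P)%:E)); last first.
  move=> y _; congr EFin; rewrite -mulr_sumr; congr (_ * _).
  rewrite -(big_mkord xpredT (fun i => S g0 i.+1 y `^ P - S g0 i y `^ P)) telescope_sumr//.
  by rewrite {2}/avgmax/= powR0 ?subr0//; exact: lt0r_neq0 (lt_trans ltr01 P1).
rewrite ball_intZ//; last 2 first.
- exact: (@measurable_avgmax_comp _ _ _ mu (fun a => a `^ P)).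
- by move=> y _; exact: powR_ge0.
rewrite -mulrA EFinM lee_wpmul2l ?lee_fin//.
apply: le_trans (doobP x0 g0 N loc_integrable_fs (fun y => powR_ge0 _ _)) _.
rewrite EFinM lee_wpmul2l ?lee_fin ?(ltW CD0)//; apply: le_trans (fA x0 g0).
rewrite le_eqVlt; apply/orP; left; apply/eqP; apply: eq_integral => y _.
by rewrite -powRrM mulrC divfK ?gt_eqF.
Qed.

(** With G = avg^(1/s), G^q splits as G^r G^(q-r), and only the second factor is estimated by (2
    M)^(q-r). By [qE], a q = k (q - r), so all powers of the volume cancel. *)
Lemma frac_term_powR x g :
  fine (frac_term mu a b f g x) `^ q <=
  (2 * A) `^ (q - r) * (avg fs x g `^ P * oscH g x `^ q).
Proof.
have V0 := V_gt0 g; have H0 := ltW (oscH_gt0 g x).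
have t0 : 0 <= fine (frac_term mu a b f g x) by rewrite fine_ge0// frac_term_ge0.
have tle : fine (frac_term mu a b f g x) <= V g `^ a * oscH g x * avg fs x g `^ s^-1.
  rewrite -lee_fin (fineK (frac_term_fin x g)); exact: frac_term_le.
have b0 : 0 <= V g `^ a * oscH g x * avg fs x g `^ s^-1 := le_trans t0 tle.
apply: (@le_trans _ _ ((V g `^ a * oscH g x * avg fs x g `^ s^-1) `^ q)).
  by apply: ge0_ler_powR; rewrite ?nnegrE// ltW.
have E2 := avg_fs_le x g; move: (avg fs x g) (avg_fs_ge0 x g) E2 => e e0 eM.
have -> : (V g `^ a * oscH g x * e `^ s^-1) `^ q =
    V g `^ (a * q) * oscH g x `^ q * e `^ (s^-1 * q).
  rewrite (powRM _ (mulr_ge0 (powR_ge0 _ _) H0) (powR_ge0 _ _)).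
  by rewrite (powRM _ (powR_ge0 _ _) H0) !powRrM.
have -> : e `^ (s^-1 * q) = e `^ P * e `^ (s^-1 * (q - r)).
  rewrite -powRD; first by congr (_ `^ _); field; exact: lt0r_neq0.
  apply/implyP; rewrite (_ : _ + _ = s^-1 * q); last by field; exact: lt0r_neq0.
  by rewrite gt_eqF// mulr_gt0 ?invr_gt0.
have M2 : 0 <= 2 * M g by rewrite mulr_ge0// ltW// M0.
have : e `^ (s^-1 * (q - r)) <= (2 * A) `^ (q - r) * V g `^ (- k * (q - r)).
  apply: (@le_trans _ _ (((2 * M g) `^ s) `^ (s^-1 * (q - r)))).
    apply: ge0_ler_powR; rewrite ?nnegrE ?powR_ge0//.
    by rewrite mulr_ge0 ?invr_ge0 ?(ltW s0)// subr_ge0.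
  have A2 : 0 <= 2 * A by rewrite mulr_ge0// ltW.
  rewrite -powRrM [s * (s^-1 * _)]mulrA (mulfV (lt0r_neq0 s0)) mul1r.
  have -> : 2 * M g = 2 * A * V g `^ (- k) by rewrite /M mulrA.
  by rewrite (powRM _ A2 (powR_ge0 _ _)) -powRrM.
move=> ele; have ek : a * q + - k * (q - r) = 0 by have := qE; lra.
apply: (@le_trans _ _ (V g `^ (a * q) * oscH g x `^ q *
   (e `^ P * ((2 * A) `^ (q - r) * V g `^ (- k * (q - r)))))).
  apply: ler_wpM2l; first by rewrite mulr_ge0 ?powR_ge0.
  by apply: ler_wpM2l => //; exact: powR_ge0.
have -> : V g `^ (- k * (q - r)) = (V g `^ (a * q))^-1.
  by rewrite -powRN; congr (_ `^ _); lra.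
have v0 : V g `^ (a * q) != 0 by rewrite gt_eqF// powR_gt0.
by rewrite le_eqVlt; apply/orP; left; apply/eqP; field.
Qed.

Definition near_max g0 N x : R :=
  runmax 0 (fun j => fine (frac_term mu a b f (g0 - j%:Z) x) `^ q) N.

Lemma measurable_near_max g0 N : measurable_fun setT (near_max g0 N).
Proof.
elim: N => [|N IH]; first exact: measurable_cst.
apply: measurable_maxr => //; apply: measurable_fun_powR.
apply: measurableT_comp; first exact: fine_measurable.
exact: (measurable_frac_term muB).
Qed.

Lemma near_max_int x0 g0 :
  (\int[mu]_(y in ballM x0 g0) ereal_sup (range (fun N => (near_max g0 N y)%:E)) <=
   ((2 * A) `^ (q - r) * (momentH * CD * (A `^ r * V g0 `^ (1 - r * k))))%:E)%E.
Proof.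
have mN N : measurable_fun setT (fun y => (near_max g0 N y)%:E).
  by apply/measurable_EFinP; exact: measurable_near_max.
have N0 N y : 0 <= near_max g0 N y by exact: (@runmax_le _ 0 _ 0 N).
apply: (@integral_sup_le _ _ _ mu x0 g0 (fun N y => (near_max g0 N y)%:E)).
- exact: mN.
- exact: measurable_ereal_sup_range.
- by move=> N y; rewrite lee_fin.
- move=> y; apply: le_trans (ereal_sup_ubound _); last by exists 0%N.
  by rewrite lee_fin.
- by move=> y i j ij; rewrite lee_fin; exact: runmax_le.
- by move=> y _; exact: lexx.
move=> N; have A2 : 0 <= (2 * A) `^ (q - r) by exact: powR_ge0.
apply: (@le_trans _ _ (\int[mu]_(y in ballM x0 g0) ((2 * A) `^ (q - r) * near_sum g0 N y)%:E)%E).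
  apply: ball_int_le.
  - exact: measurable_near_max.
  - by apply: measurable_funM => //; exact: measurable_near_sum.
  - by move=> y _; exact: N0.
  - move=> y _; apply: runmax_ub => [|j jN]; first by rewrite mulr_ge0// near_sum_ge0.
    apply: le_trans (frac_term_powR y (g0 - j%:Z)) _.
    by apply: ler_wpM2l => //; exact: near_sum_ge.
rewrite ball_intZ.
- by rewrite EFinM lee_wpmul2l ?lee_fin//; exact: near_sum_int.
- exact: measurable_near_sum.
- exact: A2.
- by move=> y _; exact: near_sum_ge0.
Qed.

(** * Contribution of the balls larger than a given ball *)

Hypothesis n0 : (0 < n)%N.

(** One level up multiplies the volume by p^n, so [V ^ (a - k)] shrinks by this factor. *)
Definition decay : R := (p%:R ^+ n) `^ (k - a).

Lemma decay_gt1 : 1 < decay.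
Proof.
apply: (@le_lt_trans _ _ (1 `^ (k - a))); first by rewrite powR1.
apply: gt0_ltr_powR; rewrite ?nnegrE ?ler01 ?exprn_ge0//.
by rewrite exprn_egt1// ?ltr1n ?prime_gt1// -lt0n.
Qed.

Lemma avg_drift x g (l : nat) : `|avg b x g - avg b x (g + l%:Z)| <= l%:R * D.
Proof.
elim: l => [|l IH]; first by rewrite addr0 subrr normr0 mul0r.
apply: le_trans (ler_distD (avg b x (g + l%:Z)) _ _) _.
rewrite -natr1 mulrDl mul1r lerD//.
have -> : g + l.+1%:Z = g + l%:Z + 1 by rewrite -addrA; congr (_ + _); rewrite -PoszD addn1.
apply: le_trans (ball_avg_dist p_pr muB lb _ _ _) _.
rewrite -(ler_pM2r (V_gt0 (g + l%:Z))) -lee_fin -ball_avgE//; last exact: loc_integrable_dist.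
exact: bmo_parent.
Qed.

(** By Bernoulli's inequality [decay ^ l >= 1 + l (decay - 1)], so [D / (decay - 1)] bounds the
    drift [l D] divided by [decay ^ l] for every [l]. *)
Definition far_shift : R := hb + D / (decay - 1).

Lemma far_shift_ge0 : 0 <= far_shift.
Proof.
have h0 : 0 <= hb by apply: le_trans hb_ge1.
have D0 : 0 <= D by apply: le_trans K0 _; exact: bmo_leD.
by rewrite /far_shift addr_ge0// divr_ge0// subr_ge0 ltW// decay_gt1.
Qed.

(** Going [l] levels up moves the average of [b] by at most [l D], while the volume factor gains
    [decay ^ l] in the denominator; the bound is therefore independent of [l]. *)
Lemma frac_term_far x0 g0 x (l : nat) : ballM x0 g0 x ->
  (frac_term mu a b f (g0 + l%:Z) x <=
   (4 * A * V g0 `^ (a - k) * (`|b x - avg b x0 g0| + far_shift))%:E)%E.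
Proof.
move=> xB; apply: le_trans (frac_term_le2 _ _) _; rewrite lee_fin.
have V0 := V_gt0 g0; have Vl := V_gt0 (g0 + l%:Z); have d1 := decay_gt1.
have h0 : 0 <= hb by apply: le_trans hb_ge1.
have D0 : 0 <= D by apply: le_trans K0 _; exact: bmo_leD.
have p0 : 0 < p%:R ^+ n :> R by rewrite exprn_gt0// ltr0n prime_gt0.
have dl : 0 < decay ^+ l by rewrite exprn_gt0// (lt_trans ltr01).
have -> : V (g0 + l%:Z) `^ a * oscH (g0 + l%:Z) x * (2 * M (g0 + l%:Z)) =
    2 * A * V g0 `^ (a - k) * (oscH (g0 + l%:Z) x / decay ^+ l).
  have -> : 2 * A * V g0 `^ (a - k) * (oscH (g0 + l%:Z) x / decay ^+ l) =
      2 * A * oscH (g0 + l%:Z) x * (V g0 `^ (a - k) / decay ^+ l) by ring.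
  have -> : V g0 `^ (a - k) / decay ^+ l = V (g0 + l%:Z) `^ a * V (g0 + l%:Z) `^ (- k).
    rewrite -powRD ?(gt_eqF Vl) ?implybT//.
    rewrite (@ballvolD R p n p_pr g0 l) powRM ?(ltW V0) ?exprn_ge0 ?(ltW p0)//; congr (_ * _).
    rewrite /decay -(powR_mulrn l (powR_ge0 _ _)) -(powR_mulrn l (ltW p0)) -powRN -!powRrM.
    by congr (_ `^ _); ring.
  by rewrite /M; ring.
have -> : 4 * A * V g0 `^ (a - k) * (`|b x - avg b x0 g0| + far_shift) =
    2 * A * V g0 `^ (a - k) * (2 * (`|b x - avg b x0 g0| + far_shift)) by ring.
apply: ler_wpM2l; first by rewrite !mulr_ge0 ?powR_ge0// ltW.
rewrite ler_pdivrMr// /oscH -mulrA ler_wpM2l//.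
have e1 := avg_drift x g0 l; rewrite (lconst_ball_avg mu b xB) in e1.
have e2 := ler_distD (avg b x0 g0) (b x) (avg b x (g0 + l%:Z)).
have e3 := @bernoulli _ (decay - 1) l (ltW _); rewrite subr_gt0 in e3.
have {}e3 := e3 d1; rewrite [1 + (_ - 1)]addrC subrK in e3.
have dm : 0 < decay - 1 by rewrite subr_gt0.
have e4 : l%:R * D <= D / (decay - 1) * decay ^+ l.
  rewrite mulrAC ler_pdivlMr// mulrAC -mulrA [leRHS]mulrC mulrA.
  by apply: ler_wpM2r => //; rewrite (le_trans _ e3)// lerDr.
have e5 : 1 <= decay ^+ l by apply: exprn_ege1; exact: ltW.
have := normr_ge0 (b x - avg b x0 g0).
rewrite /far_shift; move: e1 e2 e4 e5 dl h0.
move: (`|b x - avg b x0 g0|) (`|b x - avg b x (g0 + l%:Z)|) (`|avg b x0 g0 - avg b x (g0 + l%:Z)|).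
move: (l%:R * D) (D / (decay - 1)) (decay ^+ l) hb => LD DD dd h X Y Z *.
nra.
Qed.

Definition momentF : R := 1 + 2 ^+ t * (J t + far_shift ^+ t).

Lemma far_int x0 g0 :
  (\int[mu]_(y in ballM x0 g0)
     ((4 * A * V g0 `^ (a - k) * (`|b y - avg b x0 g0| + far_shift)) `^ q)%:E <=
   (4 `^ q * momentF * (A `^ q * V g0 `^ (1 - r * k)))%:E)%E.
Proof.
have V0 := V_gt0 g0; have f0 := far_shift_ge0.
set c := avg b x0 g0; set h1 := far_shift in f0 *.
have md : measurable_fun setT (fun y => `|b y - c|) by exact: (loc_integrable_dist muB lb c).1.
have mdt : measurable_fun setT (fun y => `|b y - c| ^+ t) by exact: measurable_funX.
set L := 4 * A * V g0 `^ (a - k).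
have L0 : 0 <= L by rewrite !mulr_ge0 ?powR_ge0// ltW.
have Lq : 0 <= L `^ q by exact: powR_ge0.
have h1t : 0 <= h1 ^+ t by exact: exprn_ge0.
have c2 : 0 <= 2 ^+ t :> R by exact: exprn_ge0.
have dt0 y : 0 <= `|b y - c| ^+ t by exact: exprn_ge0.
apply: (@le_trans _ _ (\int[mu]_(y in ballM x0 g0)
    (L `^ q * (1 + 2 ^+ t * (`|b y - c| ^+ t + h1 ^+ t)))%:E)%E).
  apply: ball_int_le.
  - by apply: measurable_fun_powR; apply: measurable_funM => //; exact: measurable_funD.
  - apply: measurable_funM => //; apply: measurable_funD => //; apply: measurable_funM => //.
    exact: measurable_funD.
  - by move=> y _; exact: powR_ge0.
  - move=> y _; rewrite (powRM _ L0 (addr_ge0 (normr_ge0 _) f0)); apply: ler_wpM2l => //.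
    apply: le_trans (powR_le1D (addr_ge0 (normr_ge0 _) f0) (ltW q_gt0) qt) _.
    by rewrite lerD2l; exact: exprD_le.
have m1 : measurable_fun setT (fun y => `|b y - c| ^+ t + h1 ^+ t) by exact: measurable_funD.
have m2 : measurable_fun setT (fun y => 2 ^+ t * (`|b y - c| ^+ t + h1 ^+ t)).
  exact: measurable_funM.
have m3 : measurable_fun setT (fun y => 1 + 2 ^+ t * (`|b y - c| ^+ t + h1 ^+ t)).
  exact: measurable_funD.
have p1 y : 0 <= `|b y - c| ^+ t + h1 ^+ t by exact: addr_ge0.
have p2 y : 0 <= 2 ^+ t * (`|b y - c| ^+ t + h1 ^+ t) by exact: mulr_ge0.
have p3 y : 0 <= 1 + 2 ^+ t * (`|b y - c| ^+ t + h1 ^+ t) by exact: addr_ge0.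
rewrite ball_intZ// ball_intD// ball_intZ// ball_intD// !(ball_int_cst muB).
have e1 := john_nirenberg p_pr muB lb K0 bK x0 g0 t.
apply: le_trans (lee_wpmul2l _ (leeD (lexx _) (lee_wpmul2l _ (leeD e1 (lexx _))))) _.
- by rewrite lee_fin.
- by rewrite lee_fin.
have -> : 4 `^ q * momentF * (A `^ q * V g0 `^ (1 - r * k)) =
    L `^ q * (1 * V g0 + 2 ^+ t * (J t * V g0 + h1 ^+ t * V g0)).
  rewrite /L !powRM ?mulr_ge0 ?powR_ge0 ?(ltW A0)// -powRrM.
  have -> : 1 - r * k = (a - k) * q + 1 by have := qE; lra.
  rewrite powRD ?(gt_eqF V0) ?implybT// powRr1 ?(ltW V0)// /momentF -/h1.
  by ring.
exact: lexx.
Qed.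

Lemma frac_sup_int x0 g0 :
  (\int[mu]_(y in ballM x0 g0)
     (ereal_sup (range (fun i : nat => frac_term mu a b f (odflt 0%R (unpickle i)) y)) `^ q) <=
   ((2 `^ (q - r) * (momentH * CD) + 4 `^ q * momentF) *
     (A `^ q * V g0 `^ (1 - r * k)))%:E)%E.
Proof.
pose near y := ereal_sup (range (fun N => (near_max g0 N y)%:E)).
pose far y := (4 * A * V g0 `^ (a - k) * (`|b y - avg b x0 g0| + far_shift)).
have mN N : measurable_fun setT (fun y => (near_max g0 N y)%:E).
  by apply/measurable_EFinP; exact: measurable_near_max.
have mnear : measurable_fun setT near by exact: measurable_ereal_sup_range.
have near0 y : (0 <= near y)%E.
  apply: le_trans (ereal_sup_ubound _); last by exists 0%N.
  exact: lexx.
have mfar : measurable_fun setT (fun y => (far y `^ q)%:E).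
  apply/measurable_EFinP; apply: measurable_fun_powR; apply: measurable_funM => //.
  by apply: measurable_funD => //; exact: (loc_integrable_dist muB lb _).1.
have far0 y : 0 <= far y.
  apply: mulr_ge0; last by apply: addr_ge0; [exact: normr_ge0|exact: far_shift_ge0].
  by apply: mulr_ge0; [apply: mulr_ge0 => //; exact: ltW|exact: powR_ge0].
have farq y : (0 <= (far y `^ q)%:E)%E by rewrite lee_fin powR_ge0.
have q0 := q_gt0.
apply: (@le_trans _ _ (\int[mu]_(y in ballM x0 g0) (near y + (far y `^ q)%:E))%E).
  apply: ge0_le_integral.
  - exact: mball.
  - by move=> y _; exact: poweR_ge0.
  - apply: measurable_funTS; apply: (measurableT_comp (measurable_poweR q)).
    by apply: measurable_ereal_sup_range => i; exact: (measurable_frac_term muB).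
  - by apply: measurable_funTS; exact: emeasurable_funD.
  - move=> y yB; set W := (near y + _)%E.
    have W0 : (0 <= W)%E by exact: adde_ge0.
    have T0 g : (0 <= frac_term mu a b f g y)%E by exact: frac_term_ge0.
    (* Each term is compared after a [q]-th root: the root of [W] then bounds the supremum of the
       terms, and the power is restored at the end. Levels up to [g0] are covered by [near], higher
       ones by [far]. *)
    have step g : (frac_term mu a b f g y <= W `^ q^-1)%E.
      suff H : (frac_term mu a b f g y `^ q <= W)%E.
        rewrite -[leLHS]poweRe1// -(mulfV (lt0r_neq0 q0)) poweRrM.
        apply: gt0_ler_poweR => //; first by rewrite invr_ge0 ltW.
          by rewrite in_itv/= poweR_ge0 leey.
        by rewrite in_itv/= W0 leey.
      have [gg0|g0g] := leP g g0.
        rewrite (lez_dist gg0).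
        set j := `|g0 - g|%N.
        apply: (@le_trans _ _ (near y)); last by rewrite /W leeDl.
        apply: le_trans (ereal_sup_ubound _); last by exists j.+1.
        rewrite -(fineK (frac_term_fin y (g0 - j%:Z))) poweR_EFin lee_fin.
        exact: (@runmax_ge _ 0 (fun j => fine (frac_term mu a b f (g0 - j%:Z) y) `^ q) j).
      rewrite (gez_dist (ltW g0g)).
      set l := `|g - g0|%N.
      apply: (@le_trans _ _ (far y `^ q)%:E); last by rewrite /W leeDr.
      rewrite -poweR_EFin; apply: gt0_ler_poweR; first exact: ltW.
      + by rewrite in_itv/= T0 leey.
      + by rewrite in_itv/= lee_fin far0 leey.
      + exact: frac_term_far.
    rewrite -[leRHS]poweRe1// -(mulVf (lt0r_neq0 q0)) poweRrM.
    apply: gt0_ler_poweR; first exact: ltW.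
    + rewrite in_itv/= leey andbT; apply: le_trans (ereal_sup_ubound _); last by exists 0%N.
      exact: T0.
    + by rewrite in_itv/= poweR_ge0 leey.
    + by apply: ge_ereal_sup => _ [i _ <-]; exact: step.
rewrite ge0_integralD; [|exact: mball|by []|exact: measurable_funTS|by []|exact: measurable_funTS].
have -> : (2 `^ (q - r) * (momentH * CD) + 4 `^ q * momentF) * (A `^ q * V g0 `^ (1 - r * k)) =
   (2 * A) `^ (q - r) * (momentH * CD * (A `^ r * V g0 `^ (1 - r * k))) +
   4 `^ q * momentF * (A `^ q * V g0 `^ (1 - r * k)).
  have -> : A `^ q = A `^ (q - r) * A `^ r by rewrite -powRD ?subrK// (gt_eqF A0) implybT.
  by rewrite powRM ?(ltW A0)//; ring.
by rewrite EFinD; apply: leeD; [exact: near_max_int|exact: far_int].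
Qed.

End Estimates.

(** * From the estimates to the equivalence with boundedness *)

Section Boundedness.
Context {R : realType} {p n : nat}.
Hypothesis p_pr : prime p.
Variable mu : {measure set (QpnM p n) -> \bar R}.
Hypothesis muB : forall (x : QpnM p n) g, mu (ballM x g) = (ballvol R p n g)%:E.
Implicit Types (x y z : QpnM p n) (g h : int).
Local Notation V := (ballvol R p n).
Local Notation mball := (measurable_ballM _ _).
Local Notation avg := (ball_avg mu).
Local Notation V_gt0 g := (@ballvol_gt0 R p n p_pr g).

Lemma isBMO_bound (b : QpnM p n -> R) : isBMO mu b -> exists2 K : R, 0 <= K &
  forall x g, (\int[mu]_(y in ballM x g) (`|b y - avg b x g|)%:E <= (K * V g)%:E)%E.
Proof.
rewrite /isBMO; set S := ereal_sup _ => Soo.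
have VS x g : ((V g)^-1%:E * \int[mu]_(y in ballM x g) (`|b y - avg b x g|)%:E <= S)%E.
  by apply: ereal_sup_ubound; exists x, g.
have S0 : (0 <= S)%E.
  apply: le_trans (VS point 0); apply: mule_ge0; last exact: ball_int_ge0.
  by rewrite lee_fin invr_ge0 ltW// (V_gt0 0).
have Sfin : S \is a fin_num by rewrite ge0_fin_numE.
exists (fine S) => [|x g]; first exact: fine_ge0.
have := VS x g; rewrite -(fineK Sfin) lee_pdivrMl ?(V_gt0 g)//.
by rewrite mulrC EFinM.
Qed.

Lemma isBMO_of_bound (b : QpnM p n -> R) (K : R) :
  (forall x g, (\int[mu]_(y in ballM x g) (`|b y - avg b x g|)%:E <= (K * V g)%:E)%E) ->
  isBMO mu b.
Proof.
move=> bK; apply: (@le_lt_trans _ _ K%:E); last exact: ltry.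
apply: ge_ereal_sup => _ [x [g ->]].
by rewrite lee_pdivrMl ?(V_gt0 g)// -EFinM mulrC; exact: bK.
Qed.

Lemma frac_term_le_max (alpha : R) b f g x :
  (frac_term mu (alpha / n%:R) b f g x <= frac_max_comm mu alpha b f x)%E.
Proof. by apply: ereal_sup_ubound; exists g. Qed.

Lemma frac_max_comm_ge0 (alpha : R) b f x : (0 <= frac_max_comm mu alpha b f x)%E.
Proof. exact: le_trans (frac_term_ge0 _ _ _ _ 0 _) (frac_term_le_max _ _ _ _ _). Qed.

(** The estimates want a bound [A > 0] although the norm may vanish; the norm plus [e / C], with [e]
    arbitrarily small, takes care of it. *)
Lemma frac_max_comm_bounded_of (alpha : R) b (r l q l' C : R) :
  measurable_fun setT b -> 0 < r -> 0 < q -> 0 < C ->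
  (forall (f : QpnM p n -> R) (A : R), measurable_fun setT f -> 0 < A ->
    (forall x g, \int[mu]_(y in ballM x g) (`|f y| `^ r)%:E <= (A `^ r * V g `^ (l / n%:R))%:E)%E ->
    forall x g, (\int[mu]_(y in ballM x g) (frac_max_comm mu alpha b f y `^ q) <=
      ((C * A) `^ q * V g `^ (l' / n%:R))%:E)%E) ->
  frac_max_comm_bounded mu alpha b r l q l'.
Proof.
move=> mb r0 q0 C0 H; exists C; split=> // f [mf foo]; split.
  exact: (measurable_frac_max_comm muB).
set N := morrey_norm mu r l _ in foo *.
have N0 : (0 <= N)%E.
  by apply: le_trans (poweR_ge0 _ _) (ereal_sup_ubound _); exists point, 0; reflexivity.
have Nfin : N \is a fin_num by rewrite ge0_fin_numE.
rewrite -(fineK Nfin) -EFinM; apply/lee_addgt0Pr => e e0.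
pose A := fine N + e / C.
have A0 : 0 < A by rewrite ltr_wpDl ?fine_ge0// divr_gt0.
have fA x g : (\int[mu]_(y in ballM x g) (`|f y| `^ r)%:E <= (A `^ r * V g `^ (l / n%:R))%:E)%E.
  move: x g; apply/(morrey_normP p_pr mu l (EFin \o f) r0 (ltW A0)).
  by rewrite -/N -(fineK Nfin) lee_fin lerDl ltW// divr_gt0.
have -> : ((C * fine N)%:E + e%:E)%E = (C * A)%:E.
  by rewrite -EFinD; congr EFin; rewrite /A; field; exact: lt0r_neq0.
apply/(morrey_normP p_pr mu l' _ q0 (ltW (mulr_gt0 C0 A0))) => x g.
under eq_integral do rewrite gee0_abs ?frac_max_comm_ge0//.
exact: H fA x g.
Qed.

Section Exponents.
Variables (b : QpnM p n -> R) (alpha r l : R).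
Hypothesis lb : loc_integrable mu b.
Hypothesis alpha0 : 0 < alpha.
Hypothesis alphan : alpha < n%:R.
Hypothesis r1 : 1 < r.
Hypothesis l0 : 0 < l.
Hypothesis ln : l < n%:R - alpha * r.

Let mb : measurable_fun setT b. Proof. by case: lb. Qed.
Let r0 : 0 < r. Proof. exact: lt_trans ltr01 r1. Qed.
Let n0 : 0 < n%:R :> R. Proof. exact: lt_trans alphan. Qed.
Let ar0 : 0 < alpha * r. Proof. exact: mulr_gt0. Qed.
Let nl0 : 0 < n%:R - l. Proof. by have := ar0; have := ln; lra. Qed.
Let nlar : 0 < n%:R - l - alpha * r. Proof. by have := ln; lra. Qed.

(** Fixes the parameters of the preceding estimates. The relation between [q] and [r] becomes
    [q (k - a) = r k], and [1 - r k] is [l / n]. *)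
Lemma bmo_morrey_estimate (q : R) : isBMO mu b -> q^-1 = r^-1 - alpha / (n%:R - l) ->
  exists2 C : R, 0 < C & forall (f : QpnM p n -> R) (A : R), measurable_fun setT f -> 0 < A ->
    (forall x g, \int[mu]_(y in ballM x g) (`|f y| `^ r)%:E <= (A `^ r * V g `^ (l / n%:R))%:E)%E ->
    forall x g, (\int[mu]_(y in ballM x g) (frac_max_comm mu alpha b f y `^ q) <=
      ((C * A) `^ q * V g `^ (l / n%:R))%:E)%E.
Proof.
move=> /isBMO_bound[K K0 bK] qV.
have qE : q = r * (n%:R - l) / (n%:R - l - alpha * r).
  rewrite -[LHS]invrK qV; field.
  by rewrite !lt0r_neq0.
have q0 : 0 < q by rewrite qE divr_gt0// mulr_gt0.
pose a := alpha / n%:R; pose k := (n%:R - l) / (n%:R * r).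
have a0 : 0 < a by rewrite divr_gt0.
have kaE : k - a = (n%:R - l - alpha * r) / (n%:R * r).
  by rewrite /k /a; field; rewrite !lt0r_neq0.
have ak : a < k by rewrite -subr_gt0 kaE divr_gt0// mulr_gt0.
have qka : q * (k - a) = r * k.
  by rewrite kaE qE /k; field; rewrite !lt0r_neq0.
have rk : 1 - r * k = l / n%:R by rewrite /k; field; rewrite !lt0r_neq0.
have rm0 : 0 < r - 1 by rewrite subr_gt0.
(* [m] is an integer so that [john_nirenberg] applies to moments of order [m], and [r < m (r - 1)]
   says precisely that the conjugate exponent [s] is below [r]. *)
pose m := (Num.truncn (r / (r - 1))).+2.
have mr : r < m%:R * (r - 1).
  rewrite -ltr_pdivrMr//; apply: lt_le_trans (truncnS_gt _) _.
  by rewrite ler_nat.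
have m1 : 1 < m%:R :> R by rewrite ltr1n.
have mm0 : 0 < m%:R - 1 :> R by rewrite subr_gt0.
have m0 : 0 < m%:R :> R by exact: lt_trans ltr01 m1.
pose s : R := m%:R / (m%:R - 1).
have s1 : 1 < s by rewrite ltr_pdivlMr// mul1r gtrBl.
have sr : s < r by rewrite ltr_pdivrMr//; move: mr; rewrite mulrBr mulrBr !mulr1 mulrC; lra.
have ms : m%:R^-1 + s^-1 = 1 by rewrite /s; field; rewrite !lt0r_neq0.
have P1 : 1 < r / s by rewrite ltr_pdivlMr ?mul1r// (lt_trans ltr01).
have [CD CD0 doobP] := doob p_pr muB P1.
pose t := (Num.truncn q).+1.
have qt : q <= t%:R by exact/ltW/truncnS_gt.
have nn0 : (0 < n)%N by move: n0; rewrite ltr0n.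
pose c := 2 `^ (q - r) * (@momentH R p n K m t * CD) + 4 `^ q * @momentF R p n K m a k t.
have c0 : 0 < c.
  rewrite ltr_wpDr//.
    rewrite mulr_ge0 ?powR_ge0// /momentF addr_ge0// mulr_ge0 ?exprn_ge0//.
    rewrite addr_ge0 ?exprn_ge0//; first exact: jn_const_ge0.
    exact: far_shift_ge0.
  rewrite mulr_gt0 ?powR_gt0// mulr_gt0//.
  exact: momentH_gt0.
exists (c `^ q^-1); first by rewrite powR_gt0.
move=> f A mf A0 fA x g.
have fA' x' g' : (\int[mu]_(y in ballM x' g') (`|f y| `^ r)%:E <= (A `^ r * V g' `^ (1 - r * k))%:E)%E.
  by rewrite rk; exact: fA.
have c'A : (c `^ q^-1 * A) `^ q = c * A `^ q.
  by rewrite powRM ?powR_ge0 ?(ltW A0)// -powRrM mulVf ?lt0r_neq0// powRr1// ltW.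
rewrite c'A -mulrA -rk; under eq_integral do rewrite frac_max_commE.
exact: (@frac_sup_int R p n p_pr mu muB b lb K K0 bK m s isT s1 ms a k r A f
  sr A0 mf fA' q t a0 ak qka qt CD CD0 doobP nn0 x g).
Qed.

Lemma bmo_bounded_same (q : R) : isBMO mu b -> q^-1 = r^-1 - alpha / (n%:R - l) ->
  frac_max_comm_bounded mu alpha b r l q l.
Proof.
move=> bmo qV; have [C C0 H] := bmo_morrey_estimate bmo qV.
apply: frac_max_comm_bounded_of mb r0 _ C0 H.
rewrite -invr_gt0 qV (_ : _ - _ = (n%:R - l - alpha * r) / (r * (n%:R - l))).
  by rewrite divr_gt0// mulr_gt0.
by field; rewrite !lt0r_neq0.
Qed.

(** [q1] is the exponent that keeps the Morrey parameter [l], and [q <= q1]. The bound of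
    [bmo_morrey_estimate] is carried over by lowering the exponent on each ball with
    [powR_split]. *)
Lemma bmo_bounded_scaled (q l' : R) : isBMO mu b -> q^-1 = r^-1 - alpha / n%:R ->
  l / r = l' / q -> frac_max_comm_bounded mu alpha b r l q l'.
Proof.
move=> bmo qV ll.
pose q1 := (r^-1 - alpha / (n%:R - l))^-1.
have q1V : q1^-1 = r^-1 - alpha / (n%:R - l) by rewrite invrK.
have [C C0 H] := bmo_morrey_estimate bmo q1V.
have nar : 0 < n%:R - alpha * r by have := nlar; have := l0; lra.
have qE : q = r * n%:R / (n%:R - alpha * r).
  by rewrite -[LHS]invrK qV; field; rewrite !lt0r_neq0.
have q1E : q1 = r * (n%:R - l) / (n%:R - l - alpha * r).
  by rewrite /q1; field; rewrite !lt0r_neq0.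
have q0 : 0 < q by rewrite qE divr_gt0// mulr_gt0.
have q10 : 0 < q1 by rewrite q1E divr_gt0// mulr_gt0.
have qq1 : q <= q1.
  rewrite -lef_pV2 ?posrE// qV q1V lerD2l lerN2 ler_wpM2l ?(ltW alpha0)//.
  by rewrite lef_pV2 ?posrE// gerBl ltW.
have q1' : 1 <= q.
  rewrite -invf_le1// qV; have : r^-1 <= 1 by rewrite invf_le1// ltW.
  have : 0 < alpha / n%:R by rewrite divr_gt0.
  lra.
have l'E : l' = q * l / r.
  have -> : q * l / r = q * (l / r) by rewrite mulrA.
  by rewrite ll mulrC divfK ?lt0r_neq0.
apply: (frac_max_comm_bounded_of mb r0 q0 (C := 2 * C)); first by rewrite mulr_gt0.
move=> f A mf A0 fA x g; have V0 := V_gt0 g.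
have CA0 : 0 < C * A by exact: mulr_gt0.
have {H} H := H f A mf A0 fA x g.
(* With this exponent the known bound on the integral of [q1]-th powers is [M ^ q1 V]; the split at
   threshold [M] then gives twice [M ^ q V]. *)
pose e := (1 - l / n%:R) / q1.
pose M := C * A * V g `^ (- e).
have M0 : 0 < M by rewrite mulr_gt0// powR_gt0.
have MP (z : R) : M `^ z = (C * A) `^ z * V g `^ (- e * z).
  by rewrite /M (powRM _ (ltW CA0) (powR_ge0 _ _)) -powRrM.
have MV : (C * A) `^ q1 * V g `^ (l / n%:R) = M `^ q1 * V g.
  rewrite MP -mulrA; congr (_ * _).
  have -> : l / n%:R = - e * q1 + 1.
    by rewrite /e mulNr divfK ?lt0r_neq0//; ring.
  by rewrite powRD ?(gt_eqF V0) ?implybT// powRr1// ltW.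
have mF : measurable_fun setT (fun y => frac_max_comm mu alpha b f y `^ q1)%E.
  apply: (measurableT_comp (measurable_poweR q1)).
  exact: (measurable_frac_max_comm muB).
apply: (@le_trans _ _ (\int[mu]_(y in ballM x g)
   ((M `^ q)%:E + (M `^ (q - q1))%:E * frac_max_comm mu alpha b f y `^ q1))%E).
  apply: ge0_le_integral.
  - exact: mball.
  - by move=> y _; exact: poweR_ge0.
  - apply: measurable_funTS; apply: (measurableT_comp (measurable_poweR q)).
    exact: (measurable_frac_max_comm muB).
  - apply: measurable_funTS; apply: emeasurable_funD; first exact: measurable_cst.
    exact: measurable_funeM.
  - move=> y _; have := frac_max_comm_ge0 alpha b f y.
    case: (frac_max_comm mu alpha b f y) => [F F0| _|//].
      rewrite !poweR_EFin -EFinM -EFinD lee_fin.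
      by apply: powR_split => //; rewrite -lee_fin.
    by rewrite !poweRyr ?lt0r_neq0// gt0_muley ?lte_fin ?powR_gt0// addey// leey.
rewrite ge0_integralD; last 5 first.
- exact: mball.
- by move=> y _; rewrite lee_fin powR_ge0.
- exact: measurable_cst.
- by move=> y _; rewrite mule_ge0 ?poweR_ge0// lee_fin powR_ge0.
- by apply: measurable_funTS; exact: measurable_funeM.
rewrite ge0_integralZl; last 4 first.
- exact: mball.
- exact: measurable_funTS.
- by move=> y _; exact: poweR_ge0.
- by rewrite lee_fin powR_ge0.
rewrite (ball_int_cst muB); rewrite MV in H.
apply: le_trans (leeD (lexx _) (lee_wpmul2l _ H)) _; first by rewrite lee_fin powR_ge0.
rewrite -EFinM -EFinD lee_fin mulrA -powRD; last by rewrite (gt_eqF M0) implybT.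
rewrite subrK -mulrDl.
have -> : (2 * C * A) `^ q * V g `^ (l' / n%:R) = 2 `^ q * (M `^ q * V g).
  rewrite -[2 * C * A]mulrA (powRM _ (ler0n _ 2) (ltW CA0)) MP -!mulrA.
  congr (_ * (_ * _)).
  have -> : l' / n%:R = - e * q + 1.
    rewrite l'E /e q1E qE; field.
    by rewrite !lt0r_neq0.
  by rewrite powRD ?(gt_eqF V0) ?implybT// powRr1// ltW.
have two : 2 <= 2 `^ q :> R by rewrite -[leLHS](@powRr1 _ 2)// ler_powR//; lra.
rewrite mulrDl -mulr2n -[leLHS]mulr_natl; apply: ler_wpM2r => //.
by apply: mulr_ge0; [exact: powR_ge0|exact: ltW].
Qed.

(** The integral is the measure of an intersection of balls, at most the smaller of the two volumes,
    which is at most their weighted geometric mean with weights [1 - l / n] and [l / n]. *)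
Lemma indic_ball_morrey x0 g0 x g :
  (\int[mu]_(y in ballM x g) (`|\1_(ballM x0 g0) y : R| `^ r)%:E <=
   ((V g0 `^ ((1 - l / n%:R) / r)) `^ r * V g `^ (l / n%:R))%:E)%E.
Proof.
have V0 := V_gt0 g0; have Vg := V_gt0 g.
have ln0 : 0 <= l / n%:R by rewrite divr_ge0 ?ltW.
have ln1 : 0 <= 1 - l / n%:R.
  by rewrite subr_ge0 ler_pdivrMr// mul1r; have := nl0; lra.
have E : (\int[mu]_(y in ballM x g) (`|\1_(ballM x0 g0) y : R| `^ r)%:E =
    mu (ballM x0 g0 `&` ballM x g))%E.
  rewrite -(@integral_indic _ _ R mu (ballM x g) mball (ballM x0 g0) mball).
  apply: eq_integral => y _; congr EFin; rewrite indicE.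
  by case: (_ \in _); rewrite /= ?normr1 ?powR1 ?normr0 ?powR0 ?lt0r_neq0.
have mI : measurable (ballM x0 g0 `&` ballM x g) by apply: measurableI; exact: mball.
rewrite E -powRrM divfK ?lt0r_neq0//.
have sp (v : R) : 0 < v -> v = v `^ (1 - l / n%:R) * v `^ (l / n%:R).
  by move=> v0; rewrite -powRD ?(gt_eqF v0) ?implybT// subrK powRr1// ltW.
have [gg|gg] := leP (V g) (V g0).
  apply: (@le_trans _ _ (V g)%:E).
    by rewrite -(muB x); apply: le_measure; rewrite ?inE//; exact: mball.
  rewrite lee_fin {1}(sp _ Vg) ler_wpM2r ?powR_ge0//.
  by apply: ge0_ler_powR; rewrite ?nnegrE// ltW.
apply: (@le_trans _ _ (V g0)%:E).
  by rewrite -(muB x0); apply: le_measure; rewrite ?inE//; exact: mball.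
rewrite lee_fin {1}(sp _ V0) ler_wpM2l ?powR_ge0//.
by apply: ge0_ler_powR; rewrite ?nnegrE// ltW.
Qed.

(* Testing the operator on the indicator function of a ball. *)
Lemma bounded_bmo (q l' : R) : 1 <= q ->
  (1 - l / n%:R) * q / r + l' / n%:R - alpha / n%:R * q = 1 ->
  frac_max_comm_bounded mu alpha b r l q l' -> isBMO mu b.
Proof.
move=> q1 expE [C [C0 H]]; have q0 : 0 < q by exact: lt_le_trans q1.
apply: (@isBMO_of_bound b (2 * C)) => x0 g0.
have V0 := V_gt0 g0; set B := ballM x0 g0; pose f : QpnM p n -> R := \1_B.
set v := V g0 `^ ((1 - l / n%:R) / r).
have v0 : 0 <= v by exact: powR_ge0.
have fv : (morrey_norm mu r l (EFin \o f) <= v%:E)%E.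
  apply/(morrey_normP p_pr mu l (EFin \o f) r0 v0) => x g.
  exact: indic_ball_morrey.
have mf : measurable_fun setT f by apply: measurable_indic; exact: mball.
have fin : in_morrey mu r l f by split => //; exact: le_lt_trans fv (ltry _).
have [mM] := H f fin.
have Cv0 : 0 <= C * v by rewrite mulr_ge0// ltW.
move=> /le_trans/(_ (lee_wpmul2l _ fv)); rewrite lee_fin -EFinM => /(_ (ltW C0)).
move=> /(morrey_normP p_pr mu l' _ q0 Cv0)/(_ x0 g0) HM.
set c := avg b x0 g0; pose a := alpha / n%:R.
have md : measurable_fun setT (fun y => `|b y - c|) by exact: (loc_integrable_dist muB lb c).1.
have mdq : measurable_fun setT (fun y => `|b y - c| `^ q) by exact: measurable_fun_powR.
(* The single radius p^g0 suffices: there the integral of |b(x) - b(y)| dominates |b(x) - b_B| times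
   the volume. *)
have low x : B x -> ((V g0 `^ a * `|b x - c|)%:E <= frac_max_comm mu alpha b f x)%E.
  move=> xB; apply: le_trans (frac_term_le_max alpha b f g0 x).
  rewrite /frac_term -/a (ballM_eq xB).
  have -> : V g0 `^ a * `|b x - c| = V g0 `^ (a - 1) * (`|b x - c| * V g0).
    rewrite [RHS]mulrCA mulrC; congr (_ * _).
    rewrite -{3}[V g0]powRr1 ?(ltW V0)// -powRD ?subrK//.
    by rewrite (gt_eqF V0) implybT.
  rewrite EFinM lee_wpmul2l ?lee_fin ?powR_ge0//.
  have -> : (\int[mu]_(y in ballM x0 g0) (`|b x - b y| * `|f y|)%:E =
      \int[mu]_(y in ballM x0 g0) (`|b y - b x|)%:E)%E.
    apply: eq_integral => y yB; rewrite /f indicE yB /= normr1 mulr1.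
    by rewrite distrC.
  rewrite (ball_avgE p_pr (loc_integrable_dist muB lb _)) lee_fin ler_pM2r// distrC.
  exact: ball_avg_dist.
(* By [expE] the powers of the volume from the operator, the norm of the indicator and the Morrey
   bound combine to the first power. *)
have K1 : (\int[mu]_(y in B) (`|b y - c| `^ q)%:E <= (C `^ q * V g0)%:E)%E.
  have w0 : 0 < V g0 `^ (a * q) by rewrite powR_gt0.
  rewrite -(@lee_pmul2l _ (V g0 `^ (a * q))%:E) ?lte_fin//.
  rewrite -(@ball_intZ _ _ _ mu x0 g0 _ _ mdq (ltW w0) (fun y _ => powR_ge0 _ _)).
  have -> : ((V g0 `^ (a * q))%:E * (C `^ q * V g0)%:E)%E =
      ((C * v) `^ q * V g0 `^ (l' / n%:R))%:E.
    rewrite -EFinM; congr EFin; rewrite powRM ?(ltW C0)// /v -powRrM.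
    rewrite mulrCA -mulrA; congr (_ * _).
    rewrite -{2}[V g0]powRr1 ?(ltW V0)// -!powRD ?(gt_eqF V0) ?implybT//.
    by congr (_ `^ _); rewrite [_ / r * q]mulrAC; have := expE; rewrite /a; lra.
  apply: le_trans HM; apply: ge0_le_integral.
  - exact: mball.
  - by move=> y _; rewrite lee_fin mulr_ge0 ?powR_ge0.
  - by apply/measurable_EFinP/measurable_funTS; exact: measurable_funM.
  - apply: measurable_funTS; apply: (measurableT_comp (measurable_poweR q)).
    exact: measurableT_comp.
  - move=> y /low Hy; rewrite gee0_abs ?frac_max_comm_ge0//.
    rewrite powRrM -powRM ?powR_ge0// -poweR_EFin; apply: gt0_ler_poweR.
    + exact: ltW.
    + by rewrite in_itv/= leey andbT lee_fin mulr_ge0 ?powR_ge0.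
    + by rewrite in_itv/= leey andbT frac_max_comm_ge0.
    + exact: Hy.
(* Lowers the exponent from [q] to 1 with threshold [C]; the constant is C + C^(1-q) C^q = 2 C. *)
apply: (@le_trans _ _ (\int[mu]_(y in B) (C + C `^ (1 - q) * `|b y - c| `^ q)%:E)%E).
  apply: ball_int_le.
  - exact: md.
  - by apply: measurable_funD => //; exact: measurable_funM.
  - by move=> y _; exact: normr_ge0.
  - move=> y _; have := @powR_split R C `|b y - c| 1 q C0 (normr_ge0 _) ltr01 q1.
    by rewrite !powRr1// ltW.
rewrite ball_intD; last 4 first.
- exact: measurable_cst.
- exact: measurable_funM.
- by move=> y _; exact: ltW.
- by move=> y _; rewrite mulr_ge0 ?powR_ge0.
rewrite ball_intZ; last 3 first.
- exact: mdq.
- exact: powR_ge0.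
- by move=> y _; exact: powR_ge0.
rewrite (ball_int_cst muB).
apply: le_trans (leeD (lexx _) (lee_wpmul2l _ K1)) _; first by rewrite lee_fin powR_ge0.
rewrite -EFinM -EFinD lee_fin mulrA -powRD; last by rewrite (gt_eqF C0) implybT.
by rewrite subrK powRr1 ?(ltW C0)// mulrDl mul1r mulrDl.
Qed.

Lemma bmo_iff_bounded_same (q : R) : q^-1 = r^-1 - alpha / (n%:R - l) ->
  isBMO mu b <-> frac_max_comm_bounded mu alpha b r l q l.
Proof.
move=> qV; split; first by move=> bmo; exact: bmo_bounded_same.
have qE : q = r * (n%:R - l) / (n%:R - l - alpha * r).
  by rewrite -[LHS]invrK qV; field; rewrite !lt0r_neq0.
apply: bounded_bmo.
  rewrite qE ler_pdivlMr// mul1r.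
  have := mulr_gt0 (_ : 0 < r - 1) nl0; rewrite subr_gt0 => /(_ r1).
  have := ar0; lra.
by rewrite qE; field; rewrite !lt0r_neq0.
Qed.

Lemma bmo_iff_bounded_scaled (q l' : R) : q^-1 = r^-1 - alpha / n%:R ->
  l / r = l' / q -> isBMO mu b <-> frac_max_comm_bounded mu alpha b r l q l'.
Proof.
move=> qV ll; split; first by move=> bmo; exact: bmo_bounded_scaled.
have nar : 0 < n%:R - alpha * r by have := nlar; have := l0; lra.
have qE : q = r * n%:R / (n%:R - alpha * r).
  by rewrite -[LHS]invrK qV; field; rewrite !lt0r_neq0.
have q0 : 0 < q by rewrite qE divr_gt0// mulr_gt0.
have l'E : l' = q * l / r.
  have -> : q * l / r = q * (l / r) by rewrite mulrA.
  by rewrite ll mulrC divfK ?lt0r_neq0.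
apply: bounded_bmo.
  rewrite qE ler_pdivlMr// mul1r.
  have := mulr_gt0 (_ : 0 < r - 1) n0; rewrite subr_gt0 => /(_ r1).
  have := ar0; lra.
by rewrite l'E qE; field; rewrite !lt0r_neq0.
Qed.

End Exponents.
End Boundedness.

Unset Implicit Arguments.

Theorem theorem4 (R : realType) (p n : nat) (hp : prime p)
  (mu : {measure set (QpnM p n) -> \bar R})
  (hmu : forall (x : QpnM p n) (gamma : int),
      mu (ballM x gamma) = (ballvol R p n gamma)%:E)
  (b : QpnM p n -> R) (hb : loc_integrable mu b)
  (alpha r lambda : R)
  (halpha : 0 < alpha) (halphan : alpha < n%:R)
  (hr1 : 1 < r) (hr2 : r < n%:R / alpha)
  (hlam1 : 0 < lambda) (hlam2 : lambda < n%:R - alpha * r) :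
  (forall q : R, q^-1 = r^-1 - alpha / (n%:R - lambda) ->
     (isBMO mu b <-> frac_max_comm_bounded mu alpha b r lambda q lambda)) /\
  (forall q mu' : R, q^-1 = r^-1 - alpha / n%:R -> lambda / r = mu' / q ->
     (isBMO mu b <-> frac_max_comm_bounded mu alpha b r lambda q mu')).
Proof.
split=> [q qV|q l' qV ll].
- exact: (bmo_iff_bounded_same hp hmu hb halpha halphan hr1 hlam1 hlam2 qV).
- exact: (bmo_iff_bounded_scaled hp hmu hb halpha halphan hr1 hlam1 hlam2 qV ll).
Qed.
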